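(* Let $K$ be a field of characteristic $0$, $F(t)=\sum_{n\ge0}a_nt^n\in K[[t]]$ with $a_0=1$, write $\log F(t)=\sum_{n\ge1}b_n\frac{t^n}{n}$, and define $R_n$ by $\sum_{n\ge0}R_nt^n=\prod_{i\ge1}F(x_it)$. Then: (a) $[s_n]R_n=a_n$ for all $n$, i.e. $\sum_{n\ge0}[s_n]R_nt^n=F(t)$. Moreover, for any homogeneous symmetric function $f$ of degree $n$, $[s_n]f$ equals the sum of the coefficients in the $h$-expansion of $f$. (b) $\sum_{n\ge0}[s_{1^n}]R_nt^n=\frac{1}{F(-t)}$. (c) For fixed $k\ge1$, $\sum_{n\ge0}[h_k^n]R_{kn}\,t^n=\exp\left(-\sum_{i\ge1}b_{ki}\frac{(-t)^i}{i}\right)$, i.e. $1/F(-t)$ with each $b_i$ replaced by $b_{ki}$. In particular $[h_n]R_n=b_n$. (d) If $i,j\ge1$ and $i+j=n$, then $[h_ih_j]R_n=b_ib_j-b_n$ if $i\ne j$, and $[h_ih_j]R_n=\frac12(b_i^2-b_n)$ if $i=j$. (e) For $k\ge 0$, $\sum_{n\ge0}R_n(1^k)t^n=F(t)^k$, where $R_n(1^k)$ denotes $R_n$ evaluated at $x_1=\cdots=x_k=1$, $x_{k+1}=x_{k+2}=\cdots=0$. (f) Let $u$ be an indeterminate and write $\frac{F(t)}{F(-ut)}=\sum_{n\ge0}P_n(u)t^n$. Then for $n\ge1$, $P_n(u)$ is a polynomial in $u$ of degree at most $n$ divisible by $1+u$, and $$\frac{P_n(u)}{1+u}=\sum_{k=0}^{n-1}\left([s_{(n-k,1^k)}]R_n\right)u^k,$$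 where $(n-k,1^k)$ denotes the hook partition with one part $n-k$ and $k$ parts equal to $1$.
   Context: For a basis $\{b_\lambda\}$ of symmetric functions, $[b_\lambda]f$ is the coefficient of $b_\lambda$ in the expansion of $f$. $s_\lambda$ are Schur functions, $h_\lambda$ complete homogeneous symmetric functions; $h_k^n$ means $h_{(k,k,\dots,k)}$ with $n$ parts, $s_n=s_{(n)}$, $s_{1^n}=s_{(1,\dots,1)}$. *)

(* Defs.v *)
From mathcomp Require Import all_boot all_order all_algebra.
From mathcomp Require Import mpoly.
From Stdlib Require Import ClassicalEpsilon.

Set Implicit Arguments.
Unset Strict Implicit.
Unset Printing Implicit Defensive.

Import GRing.Theory.
Local Open Scope ring_scope.

(** * Formal power series *)

(* A series sum_n (f n) t^n in A[[t]] is its coefficient sequence f. *)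
Definition fps (A : comNzRingType) := nat -> A.

Section PowerSeries.
Variable A : comNzRingType.
Implicit Types (f g c : fps A).

Definition fps_one : fps A := fun n => (n == 0%N)%:R.
Definition fps_add f g : fps A := fun n => f n + g n.
Definition fps_opp f : fps A := fun n => - f n.
Definition fps_mul f g : fps A := fun n => \sum_(i < n.+1) f i * g (n - i)%N.
Definition fps_pow f k : fps A := iter k (fps_mul f) fps_one.

(* f(z t) *)
Definition fps_dil (z : A) f : fps A := fun n => z ^+ n * f n.

(* sum_m (c m) g(t)^m, for g with zero constant term: as g^m has order >= m,
   only the terms m <= n contribute to t^n. *)
Definition fps_comp c g : fps A :=
  fun n => \sum_(m < n.+1) c m * fps_pow g m n.

(* 1/f = sum_m (1 - f)^m, for f with constant term 1. *)
Definition fps_inv f : fps A :=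
  fps_comp (fun=> 1) (fps_add fps_one (fps_opp f)).

End PowerSeries.

Section ExpLog.
Variable K : fieldType.

(* exp g, for g with zero constant term. *)
Definition fps_exp (g : fps K) : fps K := fps_comp (fun m => (m`!%:R)^-1) g.

(* log f = sum_(m >= 1) (-1)^(m-1) (f - 1)^m / m, for f with constant term 1. *)
Definition fps_log (f : fps K) : fps K :=
  fps_comp (fun m => if m is m'.+1 then (-1) ^+ m' / m%:R else 0)
           (fps_add f (fps_opp (fps_one K))).

(* The series sum_(i >= 1) (b i) t^i / i. *)
Definition fps_logser (b : nat -> K) : fps K :=
  fun i => if i is 0 then 0 else b i / i%:R.

End ExpLog.

(** * Partitions and symmetric functions *)

Definition is_partn (n : nat) (l : seq nat) : bool :=
  [&& sorted geq l, 0%N \notin l & sumn l == n].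

(* The partition (n), which is the empty partition when n = 0. *)
Definition row_partn (n : nat) : seq nat := if n is 0 then [::] else [:: n].

(* The list of all partitions of n: such a partition has at most n parts, all at
   most n. *)
Definition partns (n : nat) : seq (seq nat) :=
  [seq l <- [seq map val t | t : {bseq n of 'I_n.+1}] | is_partn n l].

Lemma partns_uniq n : uniq (partns n).
Proof.
rewrite filter_uniq // map_inj_uniq ?enum_uniq // => s t /inj_map eq_st.
by apply/val_inj/eq_st/val_inj.
Qed.

Lemma mem_partns n l : (l \in partns n) = is_partn n l.
Proof.
rewrite mem_filter; case: (boolP (is_partn n l)) => //= /and3P[_ l0 /eqP suml].
have lt_l k : k \in l -> (k < n.+1)%N.
  move=> kl; rewrite ltnS -suml sumnE (perm_big _ (perm_to_rem kl)) big_cons.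
  exact: leq_addr.
have size_l : (size l <= n)%N.
  rewrite -suml {lt_l suml}; elim: l l0 => //= k l IHl.
  by rewrite inE negb_or eq_sym -lt0n => /andP[k0 /IHl le_l]; rewrite -add1n leq_add.
have size_s : (size [seq inord k : 'I_n.+1 | k <- l] <= n)%N by rewrite size_map.
apply/mapP; exists (Bseq size_s); first exact: mem_enum.
rewrite /= -map_comp map_id_in // => k /lt_l lt_k /=.
by rewrite inordK.
Qed.

Section SymmetricFunctions.
Variable K : fieldType.

(* The ring of symmetric functions is taken as the inverse limit of the rings of
   symmetric polynomials: f N is f(x_1, ..., x_N, 0, 0, ...). *)
Definition varfam := forall N : nat, {mpoly K[N]}.

Definition drop_last_var N (p : {mpoly K[N.+1]}) : {mpoly K[N]} :=
  p \mPo [tuple oapp (fun j : 'I_N => 'X_j) 0 (unlift ord_max i) | i < N.+1].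

Definition homog_symfun (n : nat) (f : varfam) : Prop :=
  [/\ forall N, f N \is symmetric,
      forall N, f N \is n.-homog
    & forall N, drop_last_var (f N.+1) = f N].

(* f(1^k): x_1 = ... = x_k = 1 and x_i = 0 for i > k. *)
Definition eval_ones (k : nat) (f : varfam) : K := (f k).@[fun=> 1].

Definition hsym (k : nat) : varfam :=
  fun N => \sum_(m : 'X_{1..N < k.+1} | mdeg m == k) 'X_[m].

Definition hfun (l : seq nat) : varfam := fun N => \prod_(k <- l) hsym k N.

(* Cells (i, j) of the Young diagram of l: row i, column j, from 0. *)
Definition cell (l : seq nat) : finType :=
  {p : 'I_(size l) * 'I_(head 0%N l) | (p.2 < nth 0%N l p.1)%N}.

Definition is_ssyt (l : seq nat) N (T : {ffun cell l -> 'I_N}) : bool :=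
  [forall p : cell l, forall q : cell l,
     let: (i, j) := val p in let: (i', j') := val q in
     ((i == i') && (j <= j')%N ==> (T p <= T q)%N) &&
     ((j == j') && (i < i')%N ==> (T p < T q)%N)].

Definition schur (l : seq nat) : varfam :=
  fun N => \sum_(T : {ffun cell l -> 'I_N} | is_ssyt T) \prod_(p : cell l) 'X_(T p).

Definition is_expansion (b : seq nat -> varfam) (n : nat) (f : varfam)
    (c : seq nat -> K) : Prop :=
  forall N, f N = \sum_(l <- partns n) c l *: b l N.

(* [b_l] f for f homogeneous of degree n and l a partition of n: the l-th
   coefficient of the expansion of f in (b_m), m ranging over the partitions of
   n. The choice of c is irrelevant when (b_m) is a basis in degree n. *)
Definition bcoef (b : seq nat -> varfam) (n : nat) (f : varfam) (l : seq nat) : K :=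
  epsilon (inhabits (fun=> 0)) (is_expansion b n f) l.

(* R_n, the coefficient of t^n in prod_(i >= 1) F(x_i t). As F(0) = 1, putting
   x_i = 0 for all i > N leaves the product over i <= N, in K[x_1,...,x_N][[t]]. *)
Definition Rfun (F : fps K) (n : nat) : varfam :=
  fun N => (\big[@fps_mul {mpoly K[N]}/fps_one {mpoly K[N]}]_(i < N)
              fps_dil 'X_i (fun m => (F m)%:MP)) n.

End SymmetricFunctions.

(* Main.v *)
(* Write p_k for the power sums. If log F(t) = sum_k b_k t^k / k, then the series
   R(t) = sum_n R_n t^n and H(t) = sum_n h_n t^n satisfy log R = sum_k b_k p_k t^k / k
   and log H = sum_k p_k t^k / k. Hence R arises from H by taking the logarithm,
   multiplying its k-th coefficient by b_k, and exponentiating, and this expresses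
   R_n by a universal isobaric polynomial in h_1, h_2, ... whose coefficients are the
   [h_l] R_n. They are read off by substituting other series for H: 1 + t^k isolates
   the rectangle (k, ..., k) and gives (c), while the coefficient of X^2 for
   1 + X (t^i + t^j) isolates (i, j) and gives (d). As e_n is a universal isobaric
   polynomial in the h_k as well, by E(-t) H(t) = 1, the h_l span.

   For Schur functions, removing the largest entry of a tableau matches the
   expansion of an alternant obtained by column operations, which yields the
   bialternant formula a_delta s_l = a_(l + delta). Hence Schur functions are
   symmetric and linearly independent. In each degree there are as many of them as
   of the h_l, so both families are bases, and [s_l] f is the coefficient of
   x^(l + delta) in a_delta f. For f = R_n this is the determinant of
   a_(l_i - i + j), whose first column has two nonzero entries when l is a hook; the
   resulting recursion gives (b) and (f). Part (a) is the one-variable case. *)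

From HB Require Import structures.
Require Import Defs.
From mathcomp Require Import all_boot all_order all_algebra.
From mathcomp Require Import boolp fingroup perm mpoly zify ring.
From Stdlib Require Import ClassicalEpsilon.

Set Implicit Arguments.
Unset Strict Implicit.
Unset Printing Implicit Defensive.

Import GRing.Theory.
Local Open Scope ring_scope.

Lemma sum_uniq_eq (A : pzSemiRingType) (I : eqType) (r : seq I) (i0 : I)
  (F : I -> A) :
  uniq r -> i0 \in r -> \sum_(i <- r) F i * (i == i0)%:R = F i0.
Proof.
move=> uniq_r ri0; rewrite (bigD1_seq i0) //= eqxx mulr1 big1 ?addr0 //.
by move=> i /negPf->; rewrite mulr0.
Qed.

Lemma sum_ord_support (F : nat -> nat) m n :
    (forall i, (m <= i)%N -> F i = 0%N) -> (forall i, (n <= i)%N -> F i = 0%N) ->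
  (\sum_(i < m) F i = \sum_(i < n) F i)%N.
Proof.
have widen k k' : (k <= k')%N -> (forall i, (k <= i)%N -> F i = 0%N) ->
    (\sum_(i < k) F i = \sum_(i < k') F i)%N.
  move=> lek F0; rewrite (big_ord_widen k' F lek) big_mkcond; apply: eq_bigr => i _.
  by case: ltnP => // /F0.
by move=> Fm Fn; case: (leqP m n) => [le|/ltnW le]; [|apply/esym]; apply: widen.
Qed.

(** * The ring of formal power series *)

Section FpsRing.
Variable A : comNzRingType.
Implicit Types (f g h : fps A) (p q : {poly A}).

Definition poly_agrees n p f := forall i, (i <= n)%N -> p`_i = f i.

Lemma poly_agrees_trunc n f : poly_agrees n (\poly_(i < n.+1) f i) f.
Proof. by move=> i lein; rewrite coef_poly ltnS lein. Qed.

Lemma poly_agreesM n p q f g :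
  poly_agrees n p f -> poly_agrees n q g -> poly_agrees n (p * q) (fps_mul f g).
Proof.
move=> pf qg i lein; rewrite coefM; apply: eq_bigr => j _.
by rewrite pf ?qg // (leq_trans _ lein) ?leq_subr // -ltnS.
Qed.

Lemma fps_addA : associative (@fps_add A).
Proof. by move=> f g h; apply: funext => n; rewrite /fps_add addrA. Qed.

Lemma fps_addC : commutative (@fps_add A).
Proof. by move=> f g; apply: funext => n; rewrite /fps_add addrC. Qed.

Lemma fps_add0 : left_id (fun=> 0) (@fps_add A).
Proof. by move=> f; apply: funext => n; rewrite /fps_add add0r. Qed.

Lemma fps_addN : left_inverse (fun=> 0) (@fps_opp A) (@fps_add A).
Proof. by move=> f; apply: funext => n; rewrite /fps_add addNr. Qed.

Lemma fps_mulA : associative (@fps_mul A).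
Proof.
move=> f g h; apply: funext => n.
have [Tf Tg] := (@poly_agrees_trunc n f, @poly_agrees_trunc n g).
have Th := @poly_agrees_trunc n h.
rewrite -(poly_agreesM Tf (poly_agreesM Tg Th) (leqnn n)) mulrA.
exact: poly_agreesM (poly_agreesM Tf Tg) Th _ (leqnn n).
Qed.

Lemma fps_mulC : commutative (@fps_mul A).
Proof.
move=> f g; apply: funext => n.
have [Tf Tg] := (@poly_agrees_trunc n f, @poly_agrees_trunc n g).
by rewrite -(poly_agreesM Tf Tg (leqnn n)) mulrC (poly_agreesM Tg Tf (leqnn n)).
Qed.

Lemma fps_mul1 : left_id (fps_one A) (@fps_mul A).
Proof.
move=> f; apply: funext => n.
rewrite /fps_mul big_ord_recl /fps_one eqxx mul1r subn0 big1 ?addr0 // => i _.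
by rewrite mul0r.
Qed.

Lemma fps_mulDl : left_distributive (@fps_mul A) (@fps_add A).
Proof.
move=> f g h; apply: funext => n.
by rewrite /fps_add /fps_mul -big_split; apply: eq_bigr => i _; rewrite mulrDl.
Qed.

Lemma fps_one_neq0 : fps_one A <> (fun=> 0).
Proof. by move/(congr1 (fun f : fps A => f 0%N))/eqP; rewrite oner_eq0. Qed.

End FpsRing.

HB.instance Definition _ (A : comNzRingType) := gen_eqMixin (fps A).
HB.instance Definition _ (A : comNzRingType) := gen_choiceMixin (fps A).
HB.instance Definition _ (A : comNzRingType) := GRing.isZmodule.Build (fps A)
  (@fps_addA A) (@fps_addC A) (@fps_add0 A) (@fps_addN A).
HB.instance Definition _ (A : comNzRingType) :=
  GRing.Zmodule_isComNzRing.Build (fps A)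
  (@fps_mulA A) (@fps_mulC A) (@fps_mul1 A) (@fps_mulDl A)
  (introN eqP (@fps_one_neq0 A)).

Section FpsTheory.
Variable A : comNzRingType.
Implicit Types (f g h c : fps A).

Lemma fps_coefD f g n : (f + g) n = f n + g n. Proof. by []. Qed.
Lemma fps_coefN f n : (- f) n = - f n. Proof. by []. Qed.
Lemma fps_coefB f g n : (f - g) n = f n - g n. Proof. by []. Qed.
Lemma fps_coefM f g n : (f * g) n = \sum_(i < n.+1) f i * g (n - i)%N.
Proof. by []. Qed.
Lemma fps_coef1 n : (1 : fps A) n = (n == 0%N)%:R. Proof. by []. Qed.

Lemma fps_coefMn f k n : (f *+ k) n = f n *+ k.
Proof. by elim: k => // k IHk; rewrite !mulrS -IHk. Qed.

Lemma fps_coef_sum (I : Type) (r : seq I) (F : I -> fps A) n :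
  (\sum_(i <- r) F i) n = \sum_(i <- r) F i n.
Proof. by elim/big_rec2: _ => // i x f _ <-. Qed.

Lemma fps_coef0M f g : (f * g) 0%N = f 0%N * g 0%N.
Proof. by rewrite fps_coefM big_ord1. Qed.

Lemma fps_powE f m : fps_pow f m = f ^+ m.
Proof. by elim: m => // m IHm; rewrite exprS -IHm. Qed.

Lemma fps_coefXn_lt g m n : g 0%N = 0 -> (n < m)%N -> (g ^+ m) n = 0.
Proof.
move=> g0; elim: m n => // m IHm n ltnm;
  rewrite exprS fps_coefM big_ord_recl g0 mul0r add0r.
rewrite big1 // => i _; rewrite IHm ?mulr0 //=.
by rewrite /bump add1n; have := ltn_ord i; lia.
Qed.

Lemma fps_coef_comp c g n M : g 0%N = 0 -> (n < M)%N ->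
  fps_comp c g n = \sum_(m < M) c m * (g ^+ m) n.
Proof.
move=> g0 ltnM; rewrite /fps_comp; under eq_bigr do rewrite fps_powE.
rewrite (big_ord_widen M (fun m => c m * (g ^+ m) n)) // big_mkcond.
apply: eq_bigr => m _; case: ltnP => // ltnm.
by rewrite fps_coefXn_lt ?mulr0.
Qed.

Lemma fps_coefM_comp f c g n M : g 0%N = 0 -> (n < M)%N ->
  (f * fps_comp c g) n = \sum_(m < M) c m * (f * g ^+ m) n.
Proof.
move=> g0 ltnM; rewrite fps_coefM.
have compE i : fps_comp c g (n - i)%N = \sum_(m < M) c m * (g ^+ m) (n - i)%N.
  by apply: fps_coef_comp => //; apply: leq_ltn_trans (leq_subr _ _) ltnM.
under eq_bigr do rewrite compE mulr_sumr.
rewrite exchange_big; apply: eq_bigr => m _; rewrite fps_coefM mulr_sumr.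
by apply: eq_bigr => i _; rewrite mulrCA.
Qed.

Lemma fps_coef_signM k f n : ((-1) ^+ k * f) n = (-1) ^+ k * f n.
Proof.
by elim: k => [|k IHk]; rewrite ?mul1r // !exprS !mulN1r !mulNr fps_coefN IHk.
Qed.

Lemma fps_comp_coef0 c g : fps_comp c g 0%N = c 0%N.
Proof. by rewrite /fps_comp big_ord1 /= mulr1. Qed.

Lemma fps_mulfV f : f 0%N = 1 -> f * fps_inv f = 1.
Proof.
move=> f0; pose g := 1 - f; have g0 : g 0%N = 0 by rewrite /g fps_coefB f0 subrr.
have invE : fps_inv f = 1 + g * fps_inv f.
  apply: funext => n.
  rewrite fps_coefD [in RHS](fps_coefM_comp _ _ g0 (ltnSn n)).
  rewrite {1}/fps_inv (fps_coef_comp _ g0 (leqnSn n.+1)) big_ord_recl expr0 mul1r.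
  by congr (_ + _); apply: eq_bigr => m _; rewrite exprS.
by apply: (addIr (g * fps_inv f)); rewrite -mulrDl addrC subrK mul1r.
Qed.

Lemma fps_inv_unique f g : f 0%N = 1 -> f * g = 1 -> g = fps_inv f.
Proof. by move=> f0 fg1; rewrite -[g]mul1r -(fps_mulfV f0) mulrAC fg1 mul1r. Qed.

Definition fps_scale (z : A) f : fps A := fun n => z * f n.

Lemma fps_scaleX (z : A) f m :
  fps_scale z f ^+ m = fps_scale (z ^+ m) (f ^+ m).
Proof.
elim: m => [|m IHm]; apply: funext => n; first by rewrite /fps_scale !expr0 mul1r.
rewrite !exprS IHm /fps_scale fps_coefM [in RHS]fps_coefM mulr_sumr.
by apply: eq_bigr => i _; rewrite mulrACA.
Qed.

Lemma fps_comp_scale (z : A) c f n M : f 0%N = 0 -> (n < M)%N ->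
  fps_comp c (fps_scale z f) n = \sum_(m < M) c m * z ^+ m * (f ^+ m) n.
Proof.
move=> f0 ltnM; rewrite (fps_coef_comp _ _ ltnM);
  last by rewrite /fps_scale f0 mulr0.
by apply: eq_bigr => m _; rewrite fps_scaleX /fps_scale mulrA.
Qed.

Definition fps_X : fps A := fun n => (n == 1%N)%:R.

Lemma fps_comp_X c : fps_comp c fps_X = c.
Proof.
have XnE m n : (fps_X ^+ m) n = (m == n)%:R.
  elim: m n => [|m IHm] [|n]; rewrite ?fps_coef1 // exprS.
    by rewrite fps_coef0M mul0r.
  rewrite fps_coefM 2!big_ord_recl big1 => [|i _]; last by rewrite mul0r.
  by rewrite mul0r mul1r add0r addr0 IHm subn1 eqSS.
apply: funext => n; rewrite /fps_comp big_ord_recr big1 /= => [|m _].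
  by rewrite fps_powE XnE eqxx mulr1 add0r.
by rewrite fps_powE XnE ltn_eqF // mulr0.
Qed.

(* The Euler operator t d/dt. *)
Definition fps_theta f : fps A := fun n => n%:R * f n.

Lemma fps_theta1 : fps_theta 1 = 0.
Proof. by apply: funext => -[|n]; rewrite /fps_theta ?mul0r // fps_coef1 mulr0. Qed.

Lemma fps_theta_is_zmod_morphism : zmod_morphism fps_theta.
Proof. by move=> f g; apply: funext => n; rewrite /fps_theta fps_coefB mulrBr. Qed.

HB.instance Definition _ := GRing.isZmodMorphism.Build (fps A) (fps A) fps_theta
  fps_theta_is_zmod_morphism.

Lemma fps_thetaM f g : fps_theta (f * g) = fps_theta f * g + f * fps_theta g.
Proof.
apply: funext => n; rewrite /fps_theta fps_coefD !fps_coefM mulr_sumr -big_split.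
apply: eq_bigr => i _; rewrite /= -{1}(subnKC (leq_ord i)) natrD; ring.
Qed.

Lemma fps_thetaX g m : fps_theta (g ^+ m.+1) = fps_theta g * g ^+ m *+ m.+1.
Proof.
elim: m => [|m IHm]; first by rewrite expr1 expr0 mulr1.
by rewrite exprS fps_thetaM IHm mulrnAr mulrCA -exprS -mulrS.
Qed.

Lemma fps_theta_comp c g : g 0%N = 0 ->
  fps_theta (fps_comp c g) = fps_theta g * fps_comp (fun m => m.+1%:R * c m.+1) g.
Proof.
move=> g0; apply: funext => n; rewrite (fps_coefM_comp _ _ g0 (ltnSn n)).
rewrite /fps_theta (fps_coef_comp _ g0 (leqnSn n.+1)) mulr_sumr big_ord_recl.
rewrite expr0 mulrCA -[n%:R * _]/(fps_theta 1 n) fps_theta1 mulr0 add0r.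
apply: eq_bigr => m _; rewrite mulrCA -[n%:R * _]/(fps_theta (g ^+ m.+1) n).
by rewrite fps_thetaX fps_coefMn mulrnAr -mulrnAl mulr_natl.
Qed.

End FpsTheory.

Section FpsMorphisms.
Variables (A B : comNzRingType).

Lemma fps_dil_is_zmod_morphism (z : A) : zmod_morphism (fps_dil z).
Proof. by move=> f g; apply: funext => n; rewrite /fps_dil !fps_coefB mulrBr. Qed.

Lemma fps_dil_is_monoid_morphism (z : A) : monoid_morphism (fps_dil z).
Proof.
split=> [|f g]; apply: funext => n; rewrite /fps_dil.
  by case: n => [|n]; rewrite ?mulr1 // mulr0.
rewrite !fps_coefM mulr_sumr; apply: eq_bigr => i _.
by rewrite -{1}(subnKC (leq_ord i)) exprD mulrACA.
Qed.

HB.instance Definition _ z := GRing.isZmodMorphism.Build (fps A) (fps A) (fps_dil z)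
  (fps_dil_is_zmod_morphism z).
HB.instance Definition _ z :=
  GRing.isMonoidMorphism.Build (fps A) (fps A) (fps_dil z)
  (fps_dil_is_monoid_morphism z).

Lemma fps_dil_comp z (c g : fps A) :
  fps_dil z (fps_comp c g) = fps_comp c (fps_dil z g).
Proof.
apply: funext => n; rewrite {1}/fps_dil /fps_comp mulr_sumr; apply: eq_bigr => m _.
by rewrite !fps_powE -rmorphXn mulrCA.
Qed.

Lemma fps_dil_coef0 z (f : fps A) : fps_dil z f 0%N = f 0%N.
Proof. by rewrite /fps_dil mul1r. Qed.

Definition fps_map (phi : A -> B) (f : fps A) : fps B := fun n => phi (f n).

Variable phi : {rmorphism A -> B}.

Lemma fps_map_is_zmod_morphism : zmod_morphism (fps_map phi).
Proof. by move=> f g; apply: funext => n; rewrite /fps_map !fps_coefB rmorphB. Qed.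

Lemma fps_map_is_monoid_morphism : monoid_morphism (fps_map phi).
Proof.
split=> [|f g]; apply: funext => n; rewrite /fps_map.
  by rewrite !fps_coef1 rmorph_nat.
by rewrite !fps_coefM rmorph_sum; apply: eq_bigr => i _; rewrite rmorphM.
Qed.

HB.instance Definition _ := GRing.isZmodMorphism.Build (fps A) (fps B) (fps_map phi)
  fps_map_is_zmod_morphism.
HB.instance Definition _ :=
  GRing.isMonoidMorphism.Build (fps A) (fps B) (fps_map phi)
  fps_map_is_monoid_morphism.

Lemma fps_map_comp (c g : fps A) :
  fps_map phi (fps_comp c g) = fps_comp (phi \o c) (fps_map phi g).
Proof.
apply: funext => n; rewrite {1}/fps_map /fps_comp rmorph_sum; apply: eq_bigr => m _.
by rewrite !fps_powE -rmorphXn rmorphM.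
Qed.

Lemma fps_map_dil z (f : fps A) :
  fps_map phi (fps_dil z f) = fps_dil (phi z) (fps_map phi f).
Proof. by apply: funext => n; rewrite /fps_map /fps_dil rmorphM rmorphXn. Qed.

End FpsMorphisms.

Section SubstPower.
Variables (A : comNzRingType) (k : nat).
Hypothesis k_gt0 : (0 < k)%N.
Implicit Types (f g c : fps A).

(* f(t^k) *)
Definition fps_substX f : fps A := fun n => if (k %| n)%N then f (n %/ k)%N else 0.

Lemma fps_coef_substX f n : fps_substX f (k * n)%N = f n.
Proof. by rewrite /fps_substX dvdn_mulr // mulKn. Qed.

Lemma poly_agrees_substX n p f :
  poly_agrees n p f -> poly_agrees n (p \Po 'X^k) (fps_substX f).
Proof.
move=> pf i lein; rewrite coef_comp_poly_Xn // /fps_substX; case: ifP => // _.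
by rewrite pf // (leq_trans (leq_div _ _)).
Qed.

Lemma fps_substXM f g : fps_substX (f * g) = fps_substX f * fps_substX g.
Proof.
apply: funext => n.
have [Tf Tg] := (@poly_agrees_trunc _ n f, @poly_agrees_trunc _ n g).
rewrite -(poly_agrees_substX (poly_agreesM Tf Tg)) // rmorphM.
exact: poly_agreesM (poly_agrees_substX Tf) (poly_agrees_substX Tg) n (leqnn n).
Qed.

Lemma fps_substX1 : fps_substX 1 = 1.
Proof.
apply: funext => n; rewrite /fps_substX !fps_coef1.
case: n => [|n]; first by rewrite dvdn0 div0n.
by case: ifP => // /divnK kn; case: eqP kn => // ->.
Qed.

Lemma fps_substX_comp c g : g 0%N = 0 ->
  fps_substX (fps_comp c g) = fps_comp c (fps_substX g).
Proof.
move=> g0; apply: funext => n.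
have substXX m : fps_substX g ^+ m = fps_substX (g ^+ m).
  by elim: m => [|m IHm]; rewrite ?fps_substX1 // !exprS fps_substXM IHm.
rewrite [RHS](@fps_coef_comp _ _ _ n n.+1) ?fps_coef_substX //; last first.
  by rewrite -[0%N](muln0 k) fps_coef_substX.
under eq_bigr do rewrite substXX.
rewrite /fps_substX; case: ifP => _; last by rewrite big1 // => m _; rewrite mulr0.
by apply: fps_coef_comp; rewrite // ltnS leq_div.
Qed.

End SubstPower.

Section ExpLog.
Variables (K : fieldType) (A : comNzRingType) (iota : {rmorphism K -> A}).
Implicit Types (f g h : fps A).

Definition exp_coef (m : nat) : K := (m`!%:R)^-1.
Definition log_coef (m : nat) : K := if m is m'.+1 then (-1) ^+ m' / m%:R else 0.

(* exp g and log f over a K-algebra A with structure map iota; for A = K they are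
   convertible to [fps_exp g] and [fps_log f]. *)
Definition fps_expA g : fps A := fps_comp (iota \o exp_coef) g.
Definition fps_logA f : fps A := fps_comp (iota \o log_coef) (f - 1).

Definition fps_hadamard (b : fps K) g : fps A := fun n => iota (b n) * g n.

Definition fps_twist (b : fps K) eta : fps A :=
  fps_expA (fps_hadamard b (fps_logA eta)).

Lemma fps_expA_coef0 g : fps_expA g 0%N = 1.
Proof. by rewrite /fps_expA fps_comp_coef0 /= /exp_coef invr1 rmorph1. Qed.

Lemma fps_logA_coef0 f : fps_logA f 0%N = 0.
Proof. by rewrite /fps_logA fps_comp_coef0 /= rmorph0. Qed.

Lemma fps_dil_expA z g : fps_dil z (fps_expA g) = fps_expA (fps_dil z g).
Proof. exact: fps_dil_comp. Qed.

Hypothesis charK0 : [pchar K] =i pred0.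

Lemma natrS_neq0 n : n.+1%:R != 0 :> K.
Proof. by rewrite ((pcharf0P K).1 charK0). Qed.

Lemma mulr_natS_inj n : injective ( *%R n.+1%:R : A -> A).
Proof.
apply: (can_inj (g := *%R (iota n.+1%:R^-1))) => x.
by rewrite mulrA -(rmorph_nat iota) -rmorphM mulVf ?natrS_neq0 // rmorph1 mul1r.
Qed.

Lemma fps_theta_inj f g : fps_theta f = fps_theta g -> f 0%N = g 0%N -> f = g.
Proof.
move=> thfg fg0; apply: funext => -[//|n].
by apply: (@mulr_natS_inj n); move/(congr1 (fun h : fps A => h n.+1)): thfg.
Qed.

Lemma fps_theta_exp_unique h f g :
    fps_theta f = fps_theta h * f -> fps_theta g = fps_theta h * g ->
  f 0%N = g 0%N -> f = g.
Proof.
move=> thf thg fg0; apply: funext => n; elim/ltn_ind: n => -[//|n] IHn.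
apply: (@mulr_natS_inj n).
rewrite -[LHS]/(fps_theta f n.+1) -[RHS]/(fps_theta g n.+1) thf thg !fps_coefM.
rewrite [LHS]big_ord_recl [RHS]big_ord_recl /fps_theta !mul0r; congr (_ + _);
  apply: eq_bigr => i _.
by rewrite IHn // ltn_subrL.
Qed.

Lemma fps_theta_expA g : g 0%N = 0 ->
  fps_theta (fps_expA g) = fps_theta g * fps_expA g.
Proof.
move=> g0; rewrite fps_theta_comp //; congr (_ * fps_comp _ g);
  apply: funext => m /=.
rewrite -(rmorph_nat iota) -rmorphM /exp_coef factS natrM invfM mulrA.
by rewrite mulfV ?natrS_neq0 // mul1r.
Qed.

Lemma fps_theta_logA f : f 0%N = 1 -> fps_theta (fps_logA f) * f = fps_theta f.
Proof.
move=> f0; have f_sub1 : (f - 1) 0%N = 0 by rewrite fps_coefB f0 subrr.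
rewrite fps_theta_comp // raddfB /= fps_theta1 subr0 -mulrA.
suff -> : fps_comp (fun m => m.+1%:R * (iota \o log_coef) m.+1) (f - 1) = fps_inv f.
  by rewrite [_ * f]mulrC fps_mulfV ?mulr1.
apply: funext => n; rewrite /fps_inv /fps_comp; apply: eq_bigr => m _;
  rewrite !fps_powE /= mul1r.
rewrite -(rmorph_nat iota) -rmorphM mulrCA mulfV ?natrS_neq0 // mulr1 rmorph_sign.
rewrite -[fps_add _ _]/(1 - f) -[1 - f]opprB [in RHS]exprNn.
by rewrite fps_coef_signM.
Qed.

Lemma fps_expAD g h : g 0%N = 0 -> h 0%N = 0 ->
  fps_expA (g + h) = fps_expA g * fps_expA h.
Proof.
move=> g0 h0; apply: (@fps_theta_exp_unique (g + h)).
- by rewrite fps_theta_expA // fps_coefD g0 h0 addr0.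
- rewrite fps_thetaM !fps_theta_expA // raddfD /= mulrDl !mulrA.
  by rewrite [fps_expA g * _]mulrC.
by rewrite fps_coef0M !fps_expA_coef0 mulr1.
Qed.

Lemma fps_expA0 : fps_expA 0 = 1.
Proof.
apply: (@fps_theta_exp_unique 0); last by rewrite fps_expA_coef0.
  exact: fps_theta_expA.
by rewrite fps_theta1 mulr1 raddf0.
Qed.

Lemma fps_expA_sum (I : Type) (r : seq I) (G : I -> fps A) :
    (forall i, G i 0%N = 0) ->
  fps_expA (\sum_(i <- r) G i) = \prod_(i <- r) fps_expA (G i).
Proof.
move=> G0; elim: r => [|i r IHr]; first by rewrite !big_nil fps_expA0.
by rewrite !big_cons fps_expAD ?IHr // fps_coef_sum big1.
Qed.

Lemma fps_logAK f : f 0%N = 1 -> fps_expA (fps_logA f) = f.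
Proof.
move=> f0; apply: (@fps_theta_exp_unique (fps_logA f)).
- by rewrite fps_theta_expA // fps_logA_coef0.
- by rewrite fps_theta_logA.
by rewrite fps_expA_coef0 f0.
Qed.

Lemma fps_expAK g : g 0%N = 0 -> fps_logA (fps_expA g) = g.
Proof.
move=> g0; apply: fps_theta_inj; last by rewrite fps_logA_coef0 g0.
have exp1 := fps_expA_coef0 g.
rewrite -[LHS]mulr1 -[RHS]mulr1 -(fps_mulfV exp1) !mulrA.
by rewrite fps_theta_logA // fps_theta_expA.
Qed.

Lemma fps_inv_expA g : g 0%N = 0 -> fps_inv (fps_expA g) = fps_expA (- g).
Proof.
move=> g0; apply/esym/fps_inv_unique; first exact: fps_expA_coef0.
by rewrite -fps_expAD ?subrr ?fps_expA0 // fps_coefN g0 oppr0.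
Qed.

Lemma fps_logA_ones : fps_logA (fun=> 1) = (fun n => iota n%:R^-1).
Proof.
pose ell : fps A := fun n => iota n%:R^-1.
have ell0 : ell 0%N = 0 by rewrite /ell invr0 rmorph0.
rewrite -[RHS](fps_expAK ell0); congr fps_logA; apply: (@fps_theta_exp_unique ell).
- apply: funext => n; rewrite /fps_theta fps_coefM mulr1 big_ord_recl.
  rewrite !mul0r add0r.
  transitivity (\sum_(i < n) (1 : A)); first by rewrite sumr_const card_ord.
  apply: eq_bigr => i _; rewrite mulr1 -(rmorph_nat iota) -rmorphM.
  by rewrite mulfV ?rmorph1 ?natrS_neq0.
- exact: fps_theta_expA.
by rewrite fps_expA_coef0.
Qed.

End ExpLog.

Section ExpField.
Variable K : fieldType.

Lemma fps_exp_coef1 (g : fps K) : fps_exp g 1%N = g 1%N.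
Proof.
rewrite /fps_exp /fps_comp !big_ord_recl big_ord0 !fps_powE expr0 expr1 fps_coef1.
by rewrite invr1 mulr0 add0r mul1r addr0.
Qed.

Lemma fps_inv_dil_exp (charK0 : [pchar K] =i pred0) (g : fps K) : g 0%N = 0 ->
  fps_inv (fps_dil (-1) (fps_exp g)) = fps_exp (fps_opp (fps_dil (-1) g)).
Proof.
move=> g0; rewrite [fps_dil _ _](fps_dil_expA idfun).
by apply: (fps_inv_expA idfun charK0); rewrite fps_dil_coef0.
Qed.

End ExpField.

(** * The symmetric functions R_n *)

Section CoefProd.
Variable A : comNzRingType.

Lemma poly_agrees_prod (I : Type) (r : seq I) n (p : I -> {poly A})
  (f : I -> fps A) :
    (forall i, poly_agrees n (p i) (f i)) ->
  poly_agrees n (\prod_(i <- r) p i) (\prod_(i <- r) f i).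
Proof.
move=> pf; elim/big_rec2: _ => [i _|i f' p' _ pf']; first by rewrite coef1.
exact: poly_agreesM.
Qed.

Lemma fps_coef_prod N (f : 'I_N -> fps A) n :
  (\prod_i f i) n =
  \sum_(g : {ffun 'I_N -> 'I_n.+1} | (\sum_i g i == n)%N) \prod_i f i (g i).
Proof.
have agree i := @poly_agrees_trunc _ n (f i).
rewrite -(poly_agrees_prod _ agree (leqnn n)).
under eq_bigr do rewrite poly_def.
rewrite bigA_distr_bigA coef_sum [RHS]big_mkcond; apply: eq_bigr => g _ /=.
rewrite scaler_prod -expr_sum coefZ coefXn eq_sym.
by case: ifP; rewrite ?mulr1 ?mulr0.
Qed.

End CoefProd.

Section RFun.
Variable K : fieldType.
Implicit Types (a b g : fps K).

Definition Rseries a N : fps {mpoly K[N]} :=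
  \prod_(i < N) fps_dil 'X_i (fps_map (@mpolyC N K) a).

Lemma RseriesE a N n : Rseries a N n = Rfun a n N.
Proof. by []. Qed.

Lemma mcoeff_Rfun a n N (m : 'X_{1..N}) :
  (Rfun a n N)@_m = if mdeg m == n then \prod_i a (m i) else 0.
Proof.
pose mnm_of (g : {ffun 'I_N -> 'I_n.+1}) := [multinom g i : nat | i < N].
have coefE (g : {ffun 'I_N -> 'I_n.+1}) :
    (\prod_i fps_dil 'X_i (fps_map (@mpolyC N K) a) (g i))@_m =
    if mnm_of g == m then \prod_i a (m i) else 0.
  rewrite /fps_dil /fps_map big_split /= -rmorph_prod mulrC mcoeffCM.
  have -> : \prod_i 'X_i ^+ g i = 'X_[mnm_of g] :> {mpoly K[N]}.
    by rewrite [RHS]mpolyXE_id; apply: eq_bigr => i _; rewrite mnmE.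
  rewrite mcoeffX; case: eqP => [<-|_]; last by rewrite mulr0.
  by rewrite mulr1; apply: eq_bigr => i _; rewrite mnmE.
have degE (g : {ffun 'I_N -> 'I_n.+1}) : (\sum_i g i)%N = mdeg (mnm_of g).
  by rewrite mdegE; apply: eq_bigr => i _; rewrite mnmE.
rewrite -RseriesE /Rseries fps_coef_prod raddf_sum /=.
under eq_bigr do rewrite coefE; under eq_bigl do rewrite degE.
rewrite -big_mkcondr /=; case: eqP => [degm|/eqP degm]; last first.
  rewrite big_pred0 // => g; apply/andP => -[/eqP degg /eqP gm].
  by rewrite -gm degg eqxx in degm.
have lem i : (m i < n.+1)%N by rewrite ltnS -degm mdegE (bigD1 i) //= leq_addr.
rewrite (big_pred1 [ffun i => Ordinal (lem i)]) // => g.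
apply/andP/eqP => [[_ /eqP gm]|->].
  by apply/ffunP=> i; apply: val_inj; rewrite ffunE /= -gm mnmE.
suff -> : mnm_of [ffun i => Ordinal (lem i)] = m by rewrite degm !eqxx.
by apply/mnmP=> i; rewrite mnmE ffunE.
Qed.

Lemma hsymE k : hsym K k = Rfun (fun=> 1) k.
Proof.
apply: functional_extensionality_dep => N; apply/mpolyP=> m.
rewrite mcoeff_Rfun big1_eq /hsym raddf_sum /=.
case: eqP => [degm|/eqP degm]; last first.
  rewrite big1 // => m' /eqP degm'; rewrite mcoeffX; case: eqP => // mE.
  by rewrite -mE degm' eqxx in degm.
have ltm : (mdeg m < k.+1)%N by rewrite degm.
rewrite (bigD1 (BMultinom ltm)) /= ?degm // mcoeffX eqxx big1 ?addr0 // => m'.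
by case/andP=> _ neq; rewrite mcoeffX; case: eqP => // mE; case/eqP: neq;
  apply: val_inj.
Qed.

Lemma mesymE_Rfun k N : mesym N K k = Rfun (fun m => (m <= 1)%:R) k N.
Proof.
apply/mpolyP=> m; rewrite mcoeff_mesym mcoeff_Rfun /mechar; case: eqP => //= _.
case: (boolP [forall i, (m i <= 1)%N]) => [/forallP lem|].
  by rewrite big1 // => i _; rewrite lem.
by rewrite negb_forall => /existsP[i lei]; rewrite (bigD1 i) //= (negPf lei) mul0r.
Qed.

Lemma Rseries1 N : Rseries 1 N = 1.
Proof. by rewrite /Rseries big1 // => i _; rewrite !rmorph1. Qed.

Lemma RseriesM a b N : Rseries (a * b) N = Rseries a N * Rseries b N.
Proof. by rewrite -big_split; apply: eq_bigr => i _; rewrite !rmorphM. Qed.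

Lemma Rseries_dil z a N : Rseries (fps_dil z a) N = fps_dil z%:MP (Rseries a N).
Proof.
rewrite rmorph_prod; apply: eq_bigr => i _; apply: funext => n.
by rewrite /fps_dil /fps_map rmorphM rmorphXn mulrCA.
Qed.

Lemma Rseries_coef0 a N : a 0%N = 1 -> Rseries a N 0%N = 1.
Proof.
move=> a0; apply/mpolyP=> m; rewrite RseriesE mcoeff_Rfun mcoeff1 mdeg_eq0.
by case: eqP => // ->; rewrite big1 // => i _; rewrite mnmE.
Qed.

Lemma Rseries_inv a N : a 0%N = 1 -> Rseries (fps_inv a) N = fps_inv (Rseries a N).
Proof.
move=> a0; apply: fps_inv_unique; first exact: Rseries_coef0.
by rewrite -RseriesM fps_mulfV // Rseries1.
Qed.

Definition hseries N : fps {mpoly K[N]} := fun k => hsym K k N.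

Lemma hseriesE N : hseries N = Rseries (fun=> 1) N.
Proof. by apply: funext => k; rewrite /hseries hsymE. Qed.

Lemma hseries_coef0 N : hseries N 0%N = 1.
Proof. by rewrite hseriesE Rseries_coef0. Qed.

Lemma mesym_hseries k N : mesym N K k = fps_inv (fps_dil (-1)%:MP (hseries N)) k.
Proof.
rewrite hseriesE -Rseries_dil -Rseries_inv ?fps_dil_coef0 // mesymE_Rfun -RseriesE.
congr (Rseries _ N k); apply: fps_inv_unique; rewrite ?fps_dil_coef0 // mulrC.
apply: funext => -[|[|n]]; rewrite fps_coefM.
- by rewrite big_ord1 /fps_dil !mulr1.
- by rewrite !big_ord_recl big_ord0 /fps_dil /= !mulr1 !mul1r expr1 addr0 addNr.
rewrite 2!big_ord_recl big1 ?addr0 /fps_dil /= => [|i _]; last by rewrite mul0r.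
by rewrite !mul1r !mulr1 subn0 exprS mulN1r addNr.
Qed.

Section LogR.
Hypothesis charK0 : [pchar K] =i pred0.

Lemma Rseries_exp g N : g 0%N = 0 ->
  Rseries (fps_exp g) N =
  fps_expA (@mpolyC N K) (\sum_(i < N) fps_dil 'X_i (fps_map (@mpolyC N K) g)).
Proof.
move=> g0; rewrite fps_expA_sum // => [|i];
  last by rewrite fps_dil_coef0 /fps_map g0 mpolyC0.
by apply: eq_bigr => i _; rewrite -fps_dil_expA fps_map_comp.
Qed.

Lemma fps_logA_Rseries a N : a 0%N = 1 ->
  fps_logA (@mpolyC N K) (Rseries a N) =
  \sum_(i < N) fps_dil 'X_i (fps_map (@mpolyC N K) (fps_log a)).
Proof.
move=> a0; have loga0 : fps_log a 0%N = 0 := fps_logA_coef0 idfun a.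
have {1}-> : a = fps_exp (fps_log a) := esym (fps_logAK idfun charK0 a0).
rewrite Rseries_exp // fps_expAK // fps_coef_sum big1 // => i _.
by rewrite fps_dil_coef0 /fps_map loga0 mpolyC0.
Qed.

(* Both logarithms are sums over the variables: their coefficients of t^n are
   b_n p_n / n and p_n / n, where p_n is the n-th power sum. *)
Lemma Rseries_twist a b N : a 0%N = 1 ->
    (forall n, (0 < n)%N -> fps_log a n = b n / n%:R) ->
  Rseries a N = fps_twist (@mpolyC N K) b (hseries N).
Proof.
move=> a0 log_a; rewrite -[LHS](fps_logAK (@mpolyC N K) charK0) ?Rseries_coef0 //.
congr fps_expA; apply: funext => n; rewrite /fps_hadamard hseriesE.
have [->|n_gt0] := posnP n; first by rewrite !fps_logA_coef0 mulr0.
rewrite !fps_logA_Rseries // !fps_coef_sum mulr_sumr; apply: eq_bigr => i _.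
rewrite /fps_dil /fps_map log_a // -[fps_log _]/(fps_logA idfun _).
by rewrite fps_logA_ones //= mpolyCM mulrCA.
Qed.

End LogR.

Lemma eval_ones_Rfun a k n : eval_ones k (Rfun a n) = fps_pow a k n.
Proof.
rewrite fps_powE -[LHS]/(fps_map (meval (fun=> 1)) (Rseries a k) n) rmorph_prod.
rewrite (eq_bigr (fun=> a)) ?prodr_const ?card_ord // => i _; apply: funext => m /=.
by rewrite fps_map_dil /= mevalXU /fps_dil /fps_map mevalC expr1n mul1r.
Qed.

End RFun.

(** * Homogeneous symmetric functions *)

Section HomogSymfun.
Variable K : fieldType.
Implicit Types f g : varfam K.

Definition mnm_ext N (m : 'X_{1..N}) : 'X_{1..N.+1} :=
  [multinom oapp m 0%N (unlift ord_max i) | i < N.+1].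

Lemma mnm_ext_lift N (m : 'X_{1..N}) j : mnm_ext m (lift ord_max j) = m j.
Proof. by rewrite mnmE liftK. Qed.

Lemma mnm_ext_max N (m : 'X_{1..N}) : mnm_ext m ord_max = 0%N.
Proof. by rewrite mnmE unlift_none. Qed.

Lemma mnm_ext_restrict N (m : 'X_{1..N.+1}) : m ord_max = 0%N ->
  mnm_ext [multinom m (lift ord_max j) | j < N] = m.
Proof.
move=> m_max; apply/mnmP=> i; case: (unliftP ord_max i) => [j ->|->].
  by rewrite mnm_ext_lift mnmE.
by rewrite mnm_ext_max.
Qed.

Lemma mcoeff_drop_last_var N (p : {mpoly K[N.+1]}) m :
  (drop_last_var p)@_m = p@_(mnm_ext m).
Proof.
rewrite {2}[p]mpolyE /drop_last_var comp_mpolyEX !raddf_sum; apply: eq_bigr => m' _.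
rewrite /= !mcoeffZ mcoeffX comp_mpolyX; congr (_ * _).
rewrite (bigD1_ord ord_max) //= tnth_mktuple unlift_none /=.
under eq_bigr do rewrite tnth_mktuple liftK /=.
rewrite (_ : \prod_(i < N) _ = 'X_[[multinom m' (lift ord_max i) | i < N]]);
  last first.
  by rewrite [RHS]mpolyXE_id; apply: eq_bigr => i _; rewrite mnmE.
have [m'0|m'_gt0] := posnP (m' ord_max); last first.
  rewrite expr0n gtn_eqF // mul0r mcoeff0; case: eqP => // m'E.
  by move: m'_gt0; rewrite m'E mnm_ext_max.
rewrite m'0 mul1r mcoeffX -[in RHS](mnm_ext_restrict m'0); congr (_ : bool)%:R.
apply/eqP/eqP => [<-//|/mnmP mE]; apply/mnmP=> j.
by have := mE (lift ord_max j); rewrite !mnm_ext_lift.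
Qed.

Lemma homog_symfun_Rfun (a : fps K) n : a 0%N = 1 -> homog_symfun n (Rfun a n).
Proof.
move=> a0; split=> N.
- apply/issymP=> s; apply/mpolyP=> m; rewrite mcoeff_sym !mcoeff_Rfun mdeg_mperm.
  case: eqP => // _; rewrite [RHS](reindex_inj (@perm_inj _ s)).
  by apply: eq_bigr => i _; rewrite mnmE.
- apply/dhomogP=> m; rewrite mcoeff_msupp mcoeff_Rfun.
  by case: (mdeg m =P n) => [degm _ //|_]; rewrite eqxx.
apply/mpolyP=> m; rewrite mcoeff_drop_last_var !mcoeff_Rfun !mdegE.
rewrite !(bigD1_ord ord_max) //= mnm_ext_max a0 mul1r add0n.
by congr (if _ == _ then _ else _); apply: eq_bigr => j _; rewrite mnm_ext_lift.
Qed.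

Lemma homog_symfunB n f g : homog_symfun n f -> homog_symfun n g ->
  homog_symfun n (fun N => f N - g N).
Proof.
move=> [symf degf dropf] [symg degg dropg]; split=> N.
- by apply: rpredB; [exact: symf|exact: symg].
- by apply: rpredB; [exact: degf|exact: degg].
by rewrite -(dropf N) -(dropg N) /drop_last_var raddfB.
Qed.

Lemma homog_symfun_lincomb n (r : seq (seq nat)) (c : seq nat -> K)
  (B : seq nat -> varfam K) :
    {in r, forall l, homog_symfun n (B l)} ->
  homog_symfun n (fun N => \sum_(l <- r) c l *: B l N).
Proof.
move=> homB; split=> N.
- by rewrite big_seq; apply: rpred_sum => l /homB[symB _ _]; apply: rpredZ;
  exact: symB.
- by rewrite big_seq; apply: rpred_sum => l /homB[_ degB _]; apply: rpredZ;
  exact: degB.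
rewrite /drop_last_var raddf_sum /= big_seq [RHS]big_seq;
  apply: eq_bigr => l /homB[_ _ dropB].
by rewrite linearZ -(dropB N).
Qed.

Lemma homog_symfunM m n f g : homog_symfun m f -> homog_symfun n g ->
  homog_symfun (m + n) (fun N => f N * g N).
Proof.
move=> [symf degf dropf] [symg degg dropg]; split=> N.
- by apply: rpredM; [exact: symf|exact: symg].
- by apply: dhomogM; [exact: degf|exact: degg].
by rewrite -(dropf N) -(dropg N) /drop_last_var rmorphM.
Qed.

Lemma homog_symfun1 : homog_symfun 0 (fun N => 1 : {mpoly K[N]}).
Proof.
split=> N; [exact: rpred1|exact: dhomog1|].
by rewrite /drop_last_var rmorph1.
Qed.

Lemma homog_symfun_hfun l : homog_symfun (sumn l) (hfun K l).
Proof.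
elim: l => [|k l IHl] /=.
  have -> : hfun K [::] = fun N => 1.
    by apply: functional_extensionality_dep => N; rewrite /hfun big_nil.
  exact: homog_symfun1.
have -> : hfun K (k :: l) = fun N => hsym K k N * hfun K l N.
  by apply: functional_extensionality_dep => N; rewrite /hfun big_cons.
by apply: homog_symfunM IHl; rewrite hsymE; apply: homog_symfun_Rfun.
Qed.

(* A monomial of degree n in N > n variables misses a variable, which symmetry
   allows to be the last one. *)
Lemma homog_symfun_eq0S n f N : homog_symfun n f -> (n <= N)%N -> f N = 0 ->
  f N.+1 = 0.
Proof.
move=> [symf homf dropf] lenN fN0; apply/mpolyP=> m; rewrite mcoeff0.
have [degm|degm] := eqVneq (mdeg m) n; last exact: dhomog_nemf_coeff degm.
have [i /eqP mi0] : exists i, m i == 0%N.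
  apply/existsP; apply: contraT; rewrite negb_exists => /forallP m_neq0.
  have : (N.+1 <= mdeg m)%N.
    rewrite mdegE -[X in (X <= _)%N]card_ord -sum1_card leq_sum // => j _.
    by rewrite lt0n.
  by rewrite degm ltnNge lenN.
rewrite -(msym_coeff m (tperm i ord_max) (symf _)).
set m' := [multinom _ | _ < _];
  have m'_max : m' ord_max = 0%N by rewrite mnmE tpermR.
by rewrite -(mnm_ext_restrict m'_max) -mcoeff_drop_last_var dropf fN0 mcoeff0.
Qed.

Lemma homog_symfun_eq0 n f : homog_symfun n f -> f n = 0 -> forall N, f N = 0.
Proof.
move=> homf fn0 N; have [leNn|/ltnW] := leqP N n; last first.
  move/subnKC<-; elim: (N - n)%N => [|d IHd]; first by rewrite addn0.
  by rewrite addnS; apply: homog_symfun_eq0S homf (leq_addr _ _) IHd.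
have [_ _ dropf] := homf; rewrite -(subKn leNn).
elim: (n - N)%N (leq_subr N n) => [|d IHd] led; first by rewrite subn0.
rewrite -dropf; have := IHd (ltnW led); rewrite -subnSK // => ->.
by rewrite /drop_last_var raddf0.
Qed.

Lemma is_expansion_homog n f (B : seq nat -> varfam K) c :
    homog_symfun n f -> {in partns n, forall l, homog_symfun n (B l)} ->
    f n = \sum_(l <- partns n) c l *: B l n ->
  is_expansion B n f c.
Proof.
move=> homf homB fnE N; apply/eqP; rewrite -subr_eq0; apply/eqP; move: N.
apply: (homog_symfun_eq0 (homog_symfunB homf (homog_symfun_lincomb c homB))).
by rewrite fnE subrr.
Qed.

Lemma homog_symfun_hfun_partns n l : l \in partns n -> homog_symfun n (hfun K l).
Proof. by rewrite mem_partns => /and3P[_ _ /eqP <-]; apply: homog_symfun_hfun. Qed.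

End HomogSymfun.

(** * Isobaric polynomials in the coefficients of a series *)

Section Isobaric.
Variable K : fieldType.

Lemma is_partn_sort_cat m n l l' : is_partn m l -> is_partn n l' ->
  is_partn (m + n) (sort geq (l ++ l')).
Proof.
move=> /and3P[_ l0 /eqP suml] /and3P[_ l0' /eqP suml']; apply/and3P; split.
- by apply: sort_sorted => x y; apply: leq_total.
- by rewrite mem_sort mem_cat negb_or l0.
by rewrite (perm_sumn (permEl (perm_sort _ _))) sumn_cat suml suml'.
Qed.

Definition series_fun :=
  forall A : comNzRingType, {rmorphism K -> A} -> fps A -> A.
Implicit Types P Q : series_fun.

(* P is a polynomial with coefficients in K in the coefficients of the series, and
   weighted homogeneous of degree n when the coefficient of t^k has weight k. *)
Definition isobaric n P : Prop :=
  exists c : seq nat -> K,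
    forall (A : comNzRingType) (iota : {rmorphism K -> A}) (eta : fps A),
      eta 0%N = 1 ->
    P A iota eta = \sum_(l <- partns n) iota (c l) * \prod_(k <- l) eta k.

Lemma isobaric_eq n P Q :
    (forall (A : comNzRingType) (iota : {rmorphism K -> A}) (eta : fps A),
      eta 0%N = 1 -> P A iota eta = Q A iota eta) ->
  isobaric n P -> isobaric n Q.
Proof. by move=> eqPQ [c Pc]; exists c => A iota eta eta0; rewrite -eqPQ ?Pc. Qed.

Lemma isobaric0 n : isobaric n (fun A iota eta => 0).
Proof.
by exists (fun=> 0) => A iota eta _; rewrite big1 // => l _; rewrite rmorph0 mul0r.
Qed.

Lemma isobaricD n P Q : isobaric n P -> isobaric n Q ->
  isobaric n (fun A iota eta => P A iota eta + Q A iota eta).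
Proof.
move=> [c Pc] [d Qd]; exists (fun l => c l + d l) => A iota eta eta0.
by rewrite Pc // Qd // -big_split; apply: eq_bigr => l _; rewrite rmorphD mulrDl.
Qed.

Lemma isobaricZ n x P : isobaric n P ->
  isobaric n (fun A iota eta => iota x * P A iota eta).
Proof.
move=> [c Pc]; exists (fun l => x * c l) => A iota eta eta0.
by rewrite Pc // mulr_sumr; apply: eq_bigr => l _; rewrite rmorphM mulrA.
Qed.

Lemma isobaric_sum n (I : eqType) (r : seq I) (F : I -> series_fun) :
    {in r, forall i, isobaric n (F i)} ->
  isobaric n (fun A iota eta => \sum_(i <- r) F i A iota eta).
Proof.
elim: r => [|i r IHr] isoF.
  by apply: isobaric_eq (isobaric0 n) => A iota eta _; rewrite big_nil.
have {}IHr : isobaric n (fun A iota eta => \sum_(i <- r) F i A iota eta).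
  by apply: IHr => j rj; apply: isoF; rewrite inE rj orbT.
apply: isobaric_eq (isobaricD (isoF i (mem_head i r)) IHr) => A iota eta _.
by rewrite big_cons.
Qed.

Lemma isobaric_monomial n l : is_partn n l ->
  isobaric n (fun A iota eta => \prod_(k <- l) eta k).
Proof.
rewrite -mem_partns => ln; exists (fun l' => (l' == l)%:R) => A iota eta _.
under [RHS]eq_bigr do rewrite rmorph_nat mulrC.
by rewrite sum_uniq_eq ?partns_uniq.
Qed.

Lemma isobaric1 : isobaric 0 (fun A iota eta => 1).
Proof.
apply: isobaric_eq (isobaric_monomial (n := 0) (l := [::]) _) => //.
by move=> A iota eta _; rewrite big_nil.
Qed.

Lemma isobaric_coef n : isobaric n (fun A iota eta => eta n).
Proof.
case: n => [|n]; first by apply: isobaric_eq isobaric1 => A iota eta ->.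
apply: isobaric_eq (isobaric_monomial (n := n.+1) (l := [:: n.+1]) _).
  by move=> A iota eta _; rewrite big_seq1.
by rewrite /is_partn /= addn0 eqxx.
Qed.

Lemma isobaricM m n P Q : isobaric m P -> isobaric n Q ->
  isobaric (m + n) (fun A iota eta => P A iota eta * Q A iota eta).
Proof.
move=> [c Pc] [d Qd].
pose F l l' (A : comNzRingType) (iota : {rmorphism K -> A}) (eta : fps A) : A :=
  iota (c l) * (iota (d l') * \prod_(k <- sort geq (l ++ l')) eta k).
apply: (isobaric_eq (P := fun A iota eta =>
  \sum_(l <- partns m) \sum_(l' <- partns n) F l l' A iota eta)).
  move=> A iota eta eta0; rewrite Pc // Qd // mulr_suml; apply: eq_bigr => l _.
  rewrite mulr_sumr; apply: eq_bigr => l' _; rewrite /F.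
  by rewrite (perm_big _ (permEl (perm_sort _ _))) big_cat /=; ring.
apply: (isobaric_sum (F := fun l A iota eta =>
  \sum_(l' <- partns n) F l l' A iota eta)) => l.
rewrite mem_partns => lm; apply: (isobaric_sum (F := F l)) => l';
  rewrite mem_partns => ln'.
exact/isobaricZ/isobaricZ/isobaric_monomial/is_partn_sort_cat.
Qed.

Lemma isobaricX n P m : isobaric n P ->
  isobaric (n * m) (fun A iota eta => P A iota eta ^+ m).
Proof.
move=> isoP; elim: m => [|m IHm]; first by rewrite muln0; apply: isobaric1.
rewrite mulnS; apply: isobaric_eq (isobaricM isoP IHm) => A iota eta _.
by rewrite exprS.
Qed.

Lemma isobaric_prod (I : Type) (r : seq I) (w : I -> nat) (F : I -> series_fun) :
    (forall i, isobaric (w i) (F i)) ->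
  isobaric (\sum_(i <- r) w i)%N (fun A iota eta => \prod_(i <- r) F i A iota eta).
Proof.
move=> isoF; elim: r => [|i r IHr].
  by rewrite big_nil; apply: isobaric_eq isobaric1 => A iota eta _; rewrite big_nil.
by rewrite big_cons; apply: isobaric_eq (isobaricM (isoF i) IHr) => A iota eta _;
  rewrite big_cons.
Qed.

Definition series_op :=
  forall A : comNzRingType, {rmorphism K -> A} -> fps A -> fps A.
Implicit Types F G : series_op.

Definition isobaric_series F : Prop :=
  forall n, isobaric n (fun A iota eta => F A iota eta n).

Lemma isobaric_series1 : isobaric_series (fun A iota eta => 1).
Proof. by case=> [|n]; [exact: isobaric1|exact: isobaric0]. Qed.

Lemma isobaric_seriesB F G : isobaric_series F -> isobaric_series G ->
  isobaric_series (fun A iota eta => F A iota eta - G A iota eta).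
Proof.
move=> isoF isoG n.
apply: isobaric_eq (isobaricD (isoF n) (isobaricZ (-1) (isoG n))).
by move=> A iota eta _; rewrite rmorphN1 mulN1r.
Qed.

Lemma isobaric_seriesM F G : isobaric_series F -> isobaric_series G ->
  isobaric_series (fun A iota eta => F A iota eta * G A iota eta).
Proof.
move=> isoF isoG n.
apply: (isobaric_sum (F := fun (i : 'I_n.+1) A iota eta =>
  F A iota eta i * G A iota eta (n - i)%N)).
by move=> i _; rewrite -{1}(subnKC (leq_ord i)); apply: isobaricM.
Qed.

Lemma isobaric_seriesX F m : isobaric_series F ->
  isobaric_series (fun A iota eta => F A iota eta ^+ m).
Proof.
move=> isoF; elim: m => [|m IHm] n; first exact: isobaric_series1.
apply: isobaric_eq (isobaric_seriesM isoF IHm n) => A iota eta _.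
by rewrite exprS.
Qed.

Lemma isobaric_series_hadamard b F : isobaric_series F ->
  isobaric_series (fun A iota eta => fps_hadamard iota b (F A iota eta)).
Proof. by move=> isoF n; apply: isobaricZ. Qed.

Lemma isobaric_series_dil z F : isobaric_series F ->
  isobaric_series (fun A iota eta => fps_dil (iota z) (F A iota eta)).
Proof.
move=> isoF n; apply: isobaric_eq (isobaricZ (z ^+ n) (isoF n)) => A iota eta _.
by rewrite rmorphXn.
Qed.

Lemma isobaric_series_comp c F : isobaric_series F ->
  isobaric_series (fun A iota eta => fps_comp (iota \o c) (F A iota eta)).
Proof.
move=> isoF n; apply: (isobaric_sum (F := fun (m : 'I_n.+1) A iota eta =>
  iota (c m) * fps_pow (F A iota eta) m n)) => m _.
apply: isobaricZ; apply: isobaric_eq (isobaric_seriesX m isoF n) => A iota eta _.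
by rewrite fps_powE.
Qed.

Lemma isobaric_series_inv F : isobaric_series F ->
  isobaric_series (fun A iota eta => fps_inv (F A iota eta)).
Proof.
move=> isoF n.
have iso1F := isobaric_seriesB isobaric_series1 isoF.
apply: isobaric_eq (isobaric_series_comp (fun=> 1) iso1F n).
by move=> A iota eta _; congr fps_comp; apply: funext => m /=; rewrite rmorph1.
Qed.

Lemma isobaric_series_twist b :
  isobaric_series (fun A iota eta => fps_twist iota b eta).
Proof.
apply/isobaric_series_comp/isobaric_series_hadamard/isobaric_series_comp.
apply: isobaric_seriesB isobaric_series1.
exact: isobaric_coef.
Qed.

Lemma hfun_hseries l N : hfun K l N = \prod_(k <- l) hseries K N k.
Proof. by []. Qed.

Lemma symmetric_hfun_span n N (p : {mpoly K[N]}) :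
    p \is symmetric -> p \is n.-homog ->
  exists c, p = \sum_(l <- partns n) c l *: hfun K l N.
Proof.
move=> symp homp; have [t [<- homt]] := sym_fundamental_homog symp homp.
pose elem (A : comNzRingType) (iota : {rmorphism K -> A}) (eta : fps A) :=
  fps_inv (fps_dil (iota (-1)) eta).
have iso_elem : isobaric_series elem.
  by apply/isobaric_series_inv/isobaric_series_dil; exact: isobaric_coef.
pose P (A : comNzRingType) (iota : {rmorphism K -> A}) (eta : fps A) :=
  \sum_(m <- msupp t) iota t@_m * \prod_(i < N) elem A iota eta i.+1 ^+ m i.
have [c Pc] : isobaric n P.
  apply: (isobaric_sum (F := fun m A iota eta =>
    iota t@_m * \prod_(i < N) elem A iota eta i.+1 ^+ m i)) => m mt.
  apply: isobaricZ; rewrite -(dhomog_mf homt mt) /= /mnmwgt.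
  apply: (isobaric_prod _ (w := fun i : 'I_N => (m i * i.+1)%N)
    (F := fun i A iota eta => elem A iota eta i.+1 ^+ m i)) => i.
  by rewrite mulnC; apply/isobaricX/iso_elem.
exists c; have := Pc _ (@mpolyC N K) _ (hseries_coef0 K N).
under [in X in _ = X -> _]eq_bigr do rewrite mul_mpolyC -hfun_hseries.
move=> <-; rewrite comp_mpolyEX; apply: eq_bigr => m _;
  rewrite mul_mpolyC comp_mpolyX.
by congr (_ *: _); apply: eq_bigr => i _; rewrite tnth_mktuple mesym_hseries.
Qed.

Lemma Rfun_hfun_expansion (charK0 : [pchar K] =i pred0) (a b : fps K) n :
    a 0%N = 1 -> (forall n, (0 < n)%N -> fps_log a n = b n / n%:R) ->
  exists2 c, is_expansion (@hfun K) n (Rfun a n) c &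
    forall (A : comNzRingType) (iota : {rmorphism K -> A}) (eta : fps A),
      eta 0%N = 1 ->
    fps_twist iota b eta n =
    \sum_(l <- partns n) iota (c l) * \prod_(k <- l) eta k.
Proof.
move=> a0 log_a; have [c twistE] := isobaric_series_twist b n; exists c => // N.
rewrite -RseriesE (Rseries_twist charK0 N a0 log_a) twistE ?hseries_coef0 //.
by apply: eq_bigr => l _; rewrite mul_mpolyC.
Qed.

End Isobaric.

(** * Alternants *)

Section Alternants.
Variable A : comNzRingType.

Definition alternant (x : nat -> A) N (l : nat -> nat) : A :=
  \det (\matrix_(i < N, j < N) x i ^+ l j).

Lemma eq_alternant x N l l' :
  (forall j, (j < N)%N -> l j = l' j) -> alternant x N l = alternant x N l'.
Proof. by move=> eql; congr (\det _); apply/matrixP=> i j; rewrite !mxE eql. Qed.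

Lemma det_sum_col N (T : finType) (P : 'I_N -> pred T)
  (H : 'I_N -> 'I_N -> T -> A) :
  \det (\matrix_(i, j) \sum_(u | P j u) H i j u) =
  \sum_(mu : {ffun 'I_N -> T} | [forall j, P j (mu j)])
    \det (\matrix_(i, j) H i j (mu j)).
Proof.
rewrite -det_tr /determinant.
under eq_bigr => s _.
  under eq_bigr do rewrite !mxE.
  rewrite bigA_distr_big_dep mulr_sumr.
  over.
rewrite exchange_big /=; apply: eq_big => [mu|mu _].
  by apply/familyP/forallP.
rewrite -[RHS]/(\det _) -det_tr; apply: eq_bigr => s _; congr (_ * _).
by apply: eq_bigr => i _; rewrite !mxE.
Qed.

Lemma det_mul_row N (F : 'I_N -> 'I_N -> A) (d : 'I_N -> A) :
  \det (\matrix_(i, j) (d i * F i j)) = \prod_i d i * \det (\matrix_(i, j) F i j).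
Proof.
have -> : \prod_i d i = \det (diag_mx (\row_i d i)).
  by rewrite det_diag; apply: eq_bigr => i _; rewrite mxE.
by rewrite -det_mulmx mul_diag_mx; congr (\det _); apply/matrixP=> i j;
  rewrite !mxE.
Qed.

Lemma det_mul_col N (F : 'I_N -> 'I_N -> A) (d : 'I_N -> A) :
  \det (\matrix_(i, j) (F i j * d j)) = \det (\matrix_(i, j) F i j) * \prod_j d j.
Proof.
rewrite -det_tr mulrC -[in RHS]det_tr.
have -> : (\matrix_(i, j) F i j)^T = \matrix_(i, j) F j i.
  by apply/matrixP=> i j; rewrite !mxE.
rewrite -det_mul_row; congr (\det _); apply/matrixP=> i j; rewrite !mxE;
  exact: mulrC.
Qed.

Lemma det_sub_next_col N (F : nat -> nat -> A) (w : nat -> A) :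
  \det (\matrix_(i < N, j < N) F i j) =
  \det (\matrix_(i < N, j < N)
    (F i j - if (j.+1 < N)%N then F i j.+1 * w j else 0)).
Proof.
pose colop : 'M[A]_N := \matrix_(k, j) ((k == j)%:R - (k == j.+1 :> nat)%:R * w j).
have det_colop : \det colop = 1.
  rewrite det_trig; last first.
    apply/is_trig_mxP => i j ltij;
      rewrite mxE -val_eqE /= !ltn_eqF ?mul0r ?subr0 //.
    exact: leqW.
  by rewrite big1 // => i _; rewrite mxE eqxx (ltn_eqF (ltnSn _)) mul0r subr0.
rewrite -[LHS]mulr1 -det_colop -det_mulmx; congr (\det _); apply/matrixP=> i j.
rewrite !mxE; under eq_bigr do rewrite !mxE mulrBr; rewrite sumrB; congr (_ - _).
  rewrite (bigD1 j) //= eqxx mulr1 big1 ?addr0 // => k /negPf->.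
  by rewrite mulr0.
rewrite (eq_bigr (fun k : 'I_N => if k == j.+1 :> nat then F i k * w j else 0)).
  by rewrite -big_mkcond (big_ord1_eq _ (fun k => F i k * w j)).
by move=> k _; case: eqP => _; rewrite ?mul1r // mul0r mulr0.
Qed.

Lemma sum_exchange_power (y z : A) m n : (m <= n)%N ->
  (y - z) * \sum_(m <= k < n) y ^+ k * z ^+ (n - k.+1) =
    y ^+ n - y ^+ m * z ^+ (n - m).
Proof.
move=> lemn; rewrite mulr_sumr.
rewrite (eq_big_nat _ _
  (F2 := fun k => y ^+ k.+1 * z ^+ (n - k.+1) - y ^+ k * z ^+ (n - k))).
  by rewrite telescope_sumr // subnn expr0 mulr1.
by move=> k /andP[_ ltkn]; rewrite -[(n - k)%N]subnSK // !exprS; ring.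
Qed.

Lemma alternant_rec x N l : (forall j, (j < N)%N -> (l j.+1 <= l j)%N) ->
  alternant x N.+1 l = \prod_(i < N) (x i - x N) * x N ^+ l N *
    \det (\matrix_(i < N, j < N)
      \sum_(l j.+1 <= m < l j) x i ^+ m * x N ^+ (l j - m.+1)).
Proof.
move=> l_decr; rewrite /alternant.
rewrite (det_sub_next_col _ (fun i j => x i ^+ l j)
  (fun j => x N ^+ (l j - l j.+1))).
rewrite (expand_det_row _ ord_max) big_ord_recr /= big1 ?add0r => [|j _];
  last first.
  by rewrite mxE /= ltnS ltn_ord -exprD subnKC ?l_decr // subrr mul0r.
rewrite mxE ltnn subr0 [RHS]mulrAC [RHS]mulrC -det_mul_row; congr (_ * _).
rewrite /cofactor addnn -signr_odd odd_double mul1r.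
congr (\det _); apply/matrixP=> i j;
  rewrite !mxE !lift_max ltnS ltn_ord sum_exchange_power //.
exact: l_decr.
Qed.

Definition interlace c N (lam : nat -> nat) (mu : {ffun 'I_N -> 'I_c.+1}) : bool :=
  [forall j : 'I_N, (lam j.+1 <= mu j <= lam j)%N].

Definition zero_ext c N (mu : {ffun 'I_N -> 'I_c.+1}) (i : nat) : nat :=
  oapp (fun j : 'I_N => mu j : nat) 0%N (insub i).

Lemma zero_extE c N (mu : {ffun 'I_N -> 'I_c.+1}) (j : 'I_N) : zero_ext mu j = mu j.
Proof. by rewrite /zero_ext valK. Qed.

Lemma zero_ext_out c N (mu : {ffun 'I_N -> 'I_c.+1}) i : (N <= i)%N ->
  zero_ext mu i = 0%N.
Proof. by move=> leNi; rewrite /zero_ext insubF // ltnNge leNi. Qed.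

Definition staircase N (j : nat) : nat := (N.-1 - j)%N.

Lemma alternant_branch x c N (lam : nat -> nat) :
    (forall i, (lam i.+1 <= lam i)%N) -> (lam 0 <= c)%N ->
  alternant x N.+1 (fun j => lam j + staircase N.+1 j)%N =
  \prod_(i < N) (x i - x N) *
  \sum_(mu : {ffun 'I_N -> 'I_c.+1} | interlace lam mu)
     x N ^+ (\sum_(j < N) (lam j - mu j) + lam N) *
     alternant x N (fun j => zero_ext mu j + staircase N j)%N.
Proof.
move=> lam_decr lam0_le; have lam_le j : (lam j <= c)%N.
  by elim: j => // j; apply: leq_trans.
rewrite /staircase /= alternant_rec; last by move=> j ltjN; have := lam_decr j; lia.
rewrite subnn addn0 -mulrA; congr (_ * _).
pose entry (i j : 'I_N) (u : 'I_c.+1) :=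
  x i ^+ (u + (N.-1 - j)) * x N ^+ (lam j - u).
have entryE (i j : 'I_N) :
    \sum_(lam j.+1 + (N - j.+1) <= m < lam j + (N - j))
       x i ^+ m * x N ^+ (lam j + (N - j) - m.+1) =
    \sum_(u : 'I_c.+1 | (lam j.+1 <= u <= lam j)%N) entry i j u.
  have ltjN := ltn_ord j.
  rewrite big_addn (_ : (_ - _ = (lam j).+1)%N); last by lia.
  rewrite big_geq_mkord (big_ord_widen_cond c.+1 (fun u => lam j.+1 <= u)%N
    (fun u => x i ^+ (u + (N - j.+1)) *
              x N ^+ (lam j + (N - j) - (u + (N - j.+1)).+1))); last exact: lam_le.
  by apply: eq_bigr => u _; rewrite /entry; congr (_ ^+ _ * _ ^+ _); lia.
rewrite (_ : \matrix_(i < N, j < N) _ =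
    \matrix_(i, j) \sum_(u : 'I_c.+1 | (lam j.+1 <= u <= lam j)%N) entry i j u);
  last first.
  by apply/matrixP=> i j; rewrite !mxE entryE.
rewrite det_sum_col mulr_sumr; apply: eq_bigr => mu _.
rewrite det_mul_col addnC exprD expr_sum -mulrA; congr (_ * _); rewrite mulrC;
  congr (_ * _).
by congr (\det _); apply/matrixP=> i j; rewrite !mxE zero_extE.
Qed.

Lemma alternant_staircase_rec x N :
  alternant x N.+1 (staircase N.+1) =
  \prod_(i < N) (x i - x N) * alternant x N (staircase N).
Proof.
rewrite (@alternant_branch x 0 N (fun=> 0%N)) //; congr (_ * _).
rewrite (big_pred1 [ffun=> ord0]) => [|mu]; last first.
  have -> : mu = [ffun=> ord0] by apply/ffunP=> p; rewrite ffunE ord1.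
  by rewrite /= eqxx; apply/forallP=> j; rewrite ffunE.
rewrite big1 // expr0 mul1r; apply: eq_alternant => j ltjN.
by rewrite (zero_extE _ (Ordinal ltjN)) ffunE.
Qed.

End Alternants.

(** * Semistandard tableaux and the bialternant formula *)

Section Tableaux.
Variables (r c : nat).
Local Notation box := ('I_r * 'I_c)%type.
Implicit Types (D : {set box}) (p q : box) (lam : nat -> nat).

Definition fits_box lam :=
  [/\ forall i, (lam i.+1 <= lam i)%N, (lam 0 <= c)%N & lam r = 0%N].

Lemma fits_box_anti lam i j : fits_box lam -> (i <= j)%N -> (lam j <= lam i)%N.
Proof.
case=> lam_decr _ _ /subnKC<-; elim: (j - i)%N => [|d IHd]; first by rewrite addn0.
by rewrite addnS (leq_trans (lam_decr _)).
Qed.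

Lemma fits_box_le lam i : fits_box lam -> (lam i <= c)%N.
Proof.
by move=> fitlam; apply: leq_trans (fits_box_anti fitlam (leq0n i)) _; case: fitlam.
Qed.

Lemma fits_box_eq0 lam i j : fits_box lam -> lam i = 0%N -> (i <= j)%N ->
  lam j = 0%N.
Proof.
by move=> fitlam lam_i /(fits_box_anti fitlam); rewrite lam_i leqn0 => /eqP.
Qed.

Lemma fits_box_out lam i : fits_box lam -> (r <= i)%N -> lam i = 0%N.
Proof. by move=> fitlam; apply: fits_box_eq0 (fitlam) _; case: fitlam. Qed.

Definition young_diagram lam : {set box} := [set p : box | (p.2 < lam p.1)%N].

Definition left_justified D :=
  forall i (j j' : 'I_c), (j <= j')%N -> (i, j') \in D -> (i, j) \in D.

Definition horizontal_strip D D' :=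
  forall (i i' : 'I_r) j, (i < i')%N ->
    (i, j) \in D -> (i', j) \in D -> (i, j) \in D'.

Definition row_len D (i : nat) : nat := #|[set p in D | p.1 == i :> nat]|.

Lemma left_justified_young_diagram lam : left_justified (young_diagram lam).
Proof. by move=> i j j' lej; rewrite !inE; apply: leq_ltn_trans. Qed.

Lemma card_ord_ltn m : (m <= c)%N -> #|[set k : 'I_c | (k < m)%N]| = m.
Proof.
move=> lemc; rewrite -sum1dep_card -(big_ord_widen_cond c xpredT (fun=> 1%N)) //.
by rewrite sum1_card card_ord.
Qed.

Lemma row_lenE D (i : 'I_r) : row_len D i = #|[set k : 'I_c | (i, k) \in D]|.
Proof.
rewrite -[RHS](card_imset _ (f := pair i)); last by move=> k k' [].
apply: eq_card => -[i' k]; rewrite inE /=.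
apply/andP/imsetP => [[pD /eqP/ord_inj ii]|[k' + [-> ->]]];
  last by rewrite inE eqxx.
by exists k; rewrite ?inE -?ii.
Qed.

Lemma row_len_out D i : (r <= i)%N -> row_len D i = 0%N.
Proof.
move=> leri; apply/eqP; rewrite cards_eq0; apply/eqP/setP=> p; rewrite !inE.
by rewrite ltn_eqF ?andbF // (leq_trans _ leri).
Qed.

Lemma row_len_young_diagram lam i : fits_box lam ->
  row_len (young_diagram lam) i = lam i.
Proof.
move=> fitlam; have [ltir|leri] := ltnP i r;
  last by rewrite row_len_out // (fits_box_out fitlam).
rewrite (row_lenE _ (Ordinal ltir)) -[RHS](card_ord_ltn (fits_box_le i fitlam)).
by apply: eq_card => k; rewrite !inE.
Qed.

Lemma row_lenS D D' i : D \subset D' -> (row_len D i <= row_len D' i)%N.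
Proof.
move=> /subsetP sDD'; apply/subset_leq_card/subsetP=> p;
  rewrite !inE => /andP[/sDD'-> ->].
by [].
Qed.

Lemma card_row_len D : #|D| = (\sum_(i < r) row_len D i)%N.
Proof.
rewrite -sum1_card (partition_big (fun p : box => p.1) xpredT) //=.
by apply: eq_bigr => i _; rewrite sum1dep_card.
Qed.

Lemma mem_left_justified D i j : left_justified D ->
  ((i, j) \in D) = (j < row_len D i)%N.
Proof.
move=> leftD; rewrite row_lenE; apply/idP/idP => [ijD|].
  rewrite -(@card_ord_ltn j.+1) //; apply: subset_leq_card.
  by apply/subsetP=> k; rewrite !inE ltnS => /leftD; apply.
apply: contraLR => ijD; rewrite -leqNgt.
rewrite -[X in (_ <= X)%N](card_ord_ltn (ltnW (ltn_ord j))).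
apply: subset_leq_card; apply/subsetP=> k; rewrite !inE ltnNge.
by apply: contraL => /leftD ik; apply: contra ijD => /ik.
Qed.

Lemma young_diagram_row_len D : left_justified D -> young_diagram (row_len D) = D.
Proof. by move=> leftD; apply/setP=> -[i j]; rewrite inE -mem_left_justified. Qed.

Lemma card_young_diagram lam M : fits_box lam -> lam M = 0%N ->
  #|young_diagram lam| = (\sum_(i < M) lam i)%N.
Proof.
move=> fitlam lamM; rewrite card_row_len;
  under eq_bigr do rewrite row_len_young_diagram //.
by apply: sum_ord_support => i; [exact: fits_box_out|exact: fits_box_eq0].
Qed.

(* A tableau with entries < N is extended to the whole r x c box by the value N
   outside its shape. *)
Definition tab_valid N (T : {ffun box -> 'I_N.+1}) : bool :=
  [forall p : box, forall q : box,
     ((p.1 == q.1) && (p.2 <= q.2)%N ==> (T p <= T q)%N) &&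
     ([&& p.2 == q.2, (p.1 < q.1)%N & (T p < N)%N] ==> (T p < T q)%N)].

Definition tab_shape N m (T : {ffun box -> 'I_N.+1}) : {set box} :=
  [set p | (T p < m)%N].

Lemma tab_validP N (T : {ffun box -> 'I_N.+1}) :
  reflect ((forall i (j j' : 'I_c), (j <= j')%N -> (T (i, j) <= T (i, j'))%N) /\
           (forall (i i' : 'I_r) j, (i < i')%N -> (T (i, j) < N)%N ->
              (T (i, j) < T (i', j))%N)) (tab_valid T).
Proof.
apply: (iffP forallP) => [validT|[rowT colT] [i j]].
  split=> [i j j' lej|i i' j lti ltN].
    have /forallP/(_ (i, j'))/andP[/implyP + _] := validT (i, j).
    by apply; rewrite eqxx.
  have /forallP/(_ (i', j))/andP[_ /implyP] := validT (i, j).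
  by apply; rewrite eqxx lti.
apply/forallP => -[i' j']; apply/andP; split; apply/implyP => /=.
  by case/andP=> /eqP-> /rowT.
by case/and3P=> /eqP->; apply: colT.
Qed.

Lemma left_justified_tab_shape N m (T : {ffun box -> 'I_N.+1}) :
  tab_valid T -> left_justified (tab_shape m T).
Proof.
by case/tab_validP=> rowT _ i j j' /rowT leT; rewrite !inE; apply: leq_ltn_trans.
Qed.

Lemma tab_row_le N (T : {ffun box -> 'I_N.+1}) lam p :
  fits_box lam -> tab_valid T -> tab_shape N T = young_diagram lam ->
    p \in young_diagram lam -> (p.1 <= T p)%N.
Proof.
case: p => -[i ltir] j /= [lam_decr _ _] /tab_validP[_ colT] shT.
elim: i ltir => // i IHi ltir pD; have ltir' := ltnW ltir.
have pD' : (Ordinal ltir', j) \in young_diagram lam.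
  by move: pD; rewrite !inE /= => ltj; apply: leq_trans ltj (lam_decr i).
apply: leq_trans (colT (Ordinal ltir') (Ordinal ltir) j _ _) => //=;
  first exact: IHi.
by move: pD'; rewrite -shT inE.
Qed.

Section AddLargestEntry.
Variable N : nat.
Implicit Types (S : {ffun box -> 'I_N.+1}) (T : {ffun box -> 'I_N.+2}).

Definition tab_extend D S : {ffun box -> 'I_N.+2} :=
  [ffun p => if p \in D then inord (S p) else ord_max].

Definition tab_restrict T : {ffun box -> 'I_N.+1} :=
  [ffun p => inord (minn (T p) N)].

Lemma tab_extendE D S p : tab_extend D S p =
  (if p \in D then S p : nat else N.+1) :> nat.
Proof.
by rewrite ffunE; case: ifP => // _;
  rewrite inordK // ltnW ?ltn_ord // ltnS ltn_ord.
Qed.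

Lemma tab_restrictE T p : tab_restrict T p = minn (T p) N :> nat.
Proof. by rewrite ffunE inordK // ltnS geq_minr. Qed.

Lemma tab_shape_restrict T : tab_shape N (tab_restrict T) = tab_shape N T.
Proof. by apply/setP=> p; rewrite !inE tab_restrictE; lia. Qed.

Lemma tab_valid_restrict T : tab_valid T -> tab_valid (tab_restrict T).
Proof.
case/tab_validP=> rowT colT; apply/tab_validP; split=> [i j j' lej|i i' j lti].
  by rewrite !tab_restrictE; have := rowT i j j' lej; lia.
by rewrite !tab_restrictE => ltN; have := colT i i' j lti; lia.
Qed.

Lemma tab_shape_extend D S : tab_shape N.+1 (tab_extend D S) = D.
Proof.
apply/setP=> p; rewrite inE tab_extendE; case: ifP => _; last by rewrite ltnn.
by rewrite ltn_ord.
Qed.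

Lemma tab_shape_extend_lt D S : tab_shape N S \subset D ->
  tab_shape N (tab_extend D S) = tab_shape N S.
Proof.
move=> /subsetP sSD; apply/setP=> p; rewrite inE tab_extendE.
case: ifP => [_|pD]; first by rewrite inE.
by rewrite ltnNge leqnSn; apply/esym/negbTE/negP => /sSD; rewrite pD.
Qed.

Lemma tab_restrictK T : tab_extend (tab_shape N.+1 T) (tab_restrict T) = T.
Proof.
apply/ffunP=> p; apply: ord_inj; rewrite tab_extendE tab_restrictE inE.
by move: (T p) => u; have := ltn_ord u; case: ifP; lia.
Qed.

Lemma tab_extendK D S : tab_shape N S \subset D ->
  tab_restrict (tab_extend D S) = S.
Proof.
move=> /subsetP sSD; apply/ffunP=> p; apply: ord_inj;
  rewrite tab_restrictE tab_extendE.
have leSN : (S p <= N)%N by rewrite -ltnS ltn_ord.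
case: ifP => [_|pD]; first exact/minn_idPl.
have leNS : (N <= S p)%N.
  by rewrite leqNgt; apply/negP=> ltS; have := sSD p; rewrite inE ltS pD => /(_ isT).
by rewrite (minn_idPr (leqnSn N)); apply/eqP; rewrite eqn_leq leNS.
Qed.

Lemma tab_valid_extend D S :
    left_justified D -> horizontal_strip D (tab_shape N S) ->
  tab_valid S -> tab_valid (tab_extend D S).
Proof.
move=> leftD stripD /tab_validP[rowS colS]; apply/tab_validP.
split=> [i j j' lej|i i' j lti]; rewrite !tab_extendE.
  case: ifP => [_|ijD].
    by case: ifP => _; [exact: rowS|rewrite ltnW // ltn_ord].
  by case: ifP => // /(leftD _ _ _ lej); rewrite ijD.
case: ifP => [ijD _|]; last by rewrite ltnn.
case: ifP => [ijD'|_]; last by rewrite ltn_ord.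
by apply: colS => //; have := stripD i i' j lti ijD ijD'; rewrite inE.
Qed.

End AddLargestEntry.

Section InterlacingShapes.
Variables (N : nat) (lam : nat -> nat).
Hypothesis fitlam : fits_box lam.
Implicit Types (T : {ffun box -> 'I_N.+2}) (mu : {ffun 'I_N -> 'I_c.+1}).

Lemma interlace_le mu i : interlace lam mu -> (zero_ext mu i <= lam i)%N.
Proof.
move=> /forallP inter; have [ltiN|leNi] := ltnP i N; last by rewrite zero_ext_out.
by rewrite (zero_extE _ (Ordinal ltiN)); have /andP[] := inter (Ordinal ltiN).
Qed.

Lemma interlace_ge mu i : (i < N)%N -> interlace lam mu ->
  (lam i.+1 <= zero_ext mu i)%N.
Proof.
move=> ltiN /forallP inter.
by rewrite (zero_extE _ (Ordinal ltiN)); have /andP[] := inter (Ordinal ltiN).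
Qed.

Lemma interlace_fits_box mu : interlace lam mu -> fits_box (zero_ext mu).
Proof.
move=> inter; split=> [i||].
- have [ltiN|leNi] := ltnP i.+1 N; last by rewrite zero_ext_out.
  exact: leq_trans (interlace_le _ inter) (interlace_ge (ltnW ltiN) inter).
- exact: leq_trans (interlace_le 0 inter) (fits_box_le 0 fitlam).
by apply/eqP; rewrite -leqn0 -(fits_box_out fitlam (leqnn r)) interlace_le.
Qed.

Lemma card_young_diagram_interlace mu : interlace lam mu -> lam N.+1 = 0%N ->
  #|young_diagram lam :\: young_diagram (zero_ext mu)| =
    (\sum_(j < N) (lam j - mu j) + lam N)%N.
Proof.
move=> inter lamN; have fitmu := interlace_fits_box inter.
have sub : young_diagram (zero_ext mu) \subset young_diagram lam.
  by apply/subsetP=> p; rewrite !inE => /leq_trans; apply; apply: interlace_le.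
have muN : zero_ext mu N.+1 = 0%N by rewrite zero_ext_out.
rewrite cardsD (setIidPr sub) (card_young_diagram fitlam lamN)
  (card_young_diagram fitmu muN) -sumnB => [|i _].
  by rewrite big_ord_recr /= zero_ext_out // subn0;
    under eq_bigr do rewrite zero_extE.
exact: interlace_le.
Qed.

Definition inner_shape T : {ffun 'I_N -> 'I_c.+1} :=
  [ffun j : 'I_N => inord (row_len (tab_shape N T) j)].

Variable T : {ffun box -> 'I_N.+2}.
Hypotheses (validT : tab_valid T) (shT : tab_shape N.+1 T = young_diagram lam).

Lemma row_len_tab_shape_le i : (row_len (tab_shape N T) i <= lam i)%N.
Proof.
rewrite -(row_len_young_diagram i fitlam) -shT; apply/row_lenS/subsetP=> p;
  rewrite !inE.
exact: leqW.
Qed.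

Lemma row_len_tab_shape_ge i : (lam i.+1 <= row_len (tab_shape N T) i)%N.
Proof.
rewrite leqNgt; apply/negP=> lt_lam.
have ltir : (i.+1 < r)%N.
  by rewrite ltnNge; apply/negP=> /(fits_box_out fitlam) lam0;
    rewrite lam0 in lt_lam.
have ltc := leq_trans lt_lam (fits_box_le i.+1 fitlam).
pose k := Ordinal ltc.
pose i1 : 'I_r := Ordinal (ltnW ltir); pose i2 : 'I_r := Ordinal ltir.
have /tab_validP[_ colT] := validT.
have i2k : (T (i2, k) < N.+1)%N.
  by have /setP/(_ (i2, k)) := shT; rewrite !inE => ->.
have i1k : (N <= T (i1, k))%N.
  have := mem_left_justified i1 k (left_justified_tab_shape (m := N) validT).
  by rewrite inE /= ltnn => ltF; rewrite leqNgt ltF.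
have [lt1|ge1] := ltnP (T (i1, k)) N.+1; last first.
  have /setP/(_ (i1, k)) := shT; rewrite !inE /= ltnNge ge1 /=.
  by rewrite (leq_trans lt_lam) // fits_box_anti.
by have := colT i1 i2 k (ltnSn i) lt1; rewrite ltnNge (leq_trans _ i1k).
Qed.

Lemma row_len_tab_shape_out i : (N <= i)%N -> row_len (tab_shape N T) i = 0%N.
Proof.
move=> leNi; have [ltir|leri] := ltnP i r; last exact: row_len_out.
rewrite (row_lenE _ (Ordinal ltir)); apply/eqP; rewrite cards_eq0.
apply/eqP/setP=> k; rewrite !inE; apply/negbTE; rewrite -leqNgt.
have [ik_lam|] := boolP ((Ordinal ltir, k) \in young_diagram lam).
  exact: leq_trans leNi (tab_row_le fitlam validT shT ik_lam).
by rewrite -shT inE -leqNgt; apply: leq_trans.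
Qed.

Lemma zero_ext_inner_shape i :
  zero_ext (inner_shape T) i = row_len (tab_shape N T) i.
Proof.
have [ltiN|leNi] := ltnP i N; last by rewrite zero_ext_out // row_len_tab_shape_out.
rewrite (zero_extE _ (Ordinal ltiN)) ffunE inordK // ltnS.
exact: leq_trans (row_len_tab_shape_le i) (fits_box_le i fitlam).
Qed.

Lemma interlace_inner_shape : interlace lam (inner_shape T).
Proof.
by apply/forallP=> j; rewrite -zero_extE zero_ext_inner_shape row_len_tab_shape_le
  row_len_tab_shape_ge.
Qed.

Lemma tab_shape_inner_shape :
  tab_shape N T = young_diagram (zero_ext (inner_shape T)).
Proof.
rewrite -[LHS]young_diagram_row_len; last exact: left_justified_tab_shape.
by apply/setP=> p; rewrite !inE zero_ext_inner_shape.
Qed.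

Lemma tab_shape_eq_inner_shape mu : interlace lam mu ->
  (tab_shape N T == young_diagram (zero_ext mu)) = (inner_shape T == mu).
Proof.
move=> inter; apply/eqP/eqP => [shTN|<-]; last exact: tab_shape_inner_shape.
apply/ffunP=> j; apply: ord_inj; rewrite -!zero_extE zero_ext_inner_shape shTN.
exact/row_len_young_diagram/interlace_fits_box.
Qed.

End InterlacingShapes.

Section GenFun.
Variables (A : comNzRingType) (x : nat -> A).

Definition tab_genfun D N : A :=
  \sum_(T : {ffun box -> 'I_N.+1} | tab_valid T && (tab_shape N T == D))
    \prod_(p in D) x (T p).

(* The tableaux of shape D whose entries equal to N fill the horizontal strip
   D - D'. *)
Lemma tab_genfun_strip D D' N :
    D' \subset D -> left_justified D -> horizontal_strip D D' ->
  \sum_(T : {ffun box -> 'I_N.+2} |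
      [&& tab_valid T, tab_shape N.+1 T == D & tab_shape N T == D'])
    \prod_(p in D) x (T p) = x N ^+ #|D :\: D'| * tab_genfun D' N.
Proof.
move=> sD'D leftD stripD.
rewrite (reindex_onto (tab_extend D) (@tab_restrict N)); last first.
  by move=> T /and3P[_ /eqP<- _]; apply: tab_restrictK.
rewrite /tab_genfun mulr_sumr; apply: eq_big => [S|S /andP[/and3P[_ _ /eqP shS] _]].
  apply/andP/andP => [[/and3P[validT _ /eqP shS] /eqP <-]|[validS /eqP shS]].
    by rewrite tab_valid_restrict // tab_shape_restrict shS eqxx.
  have sSD : tab_shape N S \subset D by rewrite shS.
  rewrite tab_shape_extend tab_shape_extend_lt // shS tab_extendK // !eqxx !andbT.
  by split=> //; apply: tab_valid_extend validS; rewrite ?shS.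
rewrite (big_setID D') /= (setIidPr sD'D) mulrC; congr (_ * _).
  rewrite (eq_bigr (fun=> x N)) ?prodr_const // => p /setDP[pD].
  rewrite -shS inE tab_extendE pD -leqNgt => leNS.
  by congr x; apply/eqP; rewrite eqn_leq leNS andbT -ltnS ltn_ord.
by apply: eq_bigr => p pD'; rewrite tab_extendE (subsetP sD'D).
Qed.

Lemma tab_genfun_branch N lam : fits_box lam -> lam N.+1 = 0%N ->
  tab_genfun (young_diagram lam) N.+1 =
  \sum_(mu : {ffun 'I_N -> 'I_c.+1} | interlace lam mu)
    x N ^+ #|young_diagram lam :\: young_diagram (zero_ext mu)| *
    tab_genfun (young_diagram (zero_ext mu)) N.
Proof.
move=> fitlam lamN.
rewrite {1}/tab_genfun (partition_big (@inner_shape N) (@interlace c N lam)) /=;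
  last first.
  by move=> T /andP[validT /eqP shT]; apply: interlace_inner_shape.
apply: eq_bigr => mu inter; rewrite -tab_genfun_strip; last 3 first.
- by apply/subsetP=> p; rewrite !inE => /leq_trans; apply; apply: interlace_le.
- exact: left_justified_young_diagram.
- move=> i i' j lti; rewrite !inE /= => _ ltj.
  have {}ltj : (j < lam i.+1)%N := leq_trans ltj (fits_box_anti fitlam lti).
  have [ltiN|leNi] := ltnP i N;
    first exact: leq_trans ltj (interlace_ge ltiN inter).
  by move: ltj; rewrite (fits_box_eq0 fitlam lamN).
apply: eq_bigl => T; have [validT|] //= := boolP (tab_valid T).
by have [shT|] //= := eqVneq (tab_shape N.+1 T) (young_diagram lam);
  rewrite (tab_shape_eq_inner_shape fitlam).
Qed.

Lemma tab_genfun_eq0 N lam p : fits_box lam -> p \in young_diagram lam ->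
  (N <= p.1)%N -> tab_genfun (young_diagram lam) N = 0.
Proof.
move=> fitlam pD leN; rewrite /tab_genfun big1 // => T /andP[validT /eqP shT].
have := tab_row_le fitlam validT shT pD.
by move: pD; rewrite -shT inE ltnNge => /negP + leT; case; apply: leq_trans leT.
Qed.

Lemma tab_genfun_set0 : tab_genfun set0 0 = 1.
Proof.
rewrite /tab_genfun (big_pred1 [ffun=> ord0]) ?big_set0 // => T.
have -> : T = [ffun=> ord0] by apply/ffunP=> p; rewrite ffunE ord1.
rewrite /= eqxx; apply/andP; split.
  by apply/tab_validP; split=> [i j j' _|i i' j _]; rewrite !ffunE.
by apply/eqP/setP=> p; rewrite !inE.
Qed.

Lemma tab_bialternant N lam : fits_box lam -> lam N = 0%N ->
  alternant x N (staircase N) * tab_genfun (young_diagram lam) N =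
  alternant x N (fun j => lam j + staircase N j)%N.
Proof.
elim: N lam => [|N IHN] lam fitlam lamN.
  have -> : young_diagram lam = set0.
    by apply/setP=> p; rewrite !inE (fits_box_eq0 fitlam lamN).
  by rewrite /alternant !det_mx00 mul1r tab_genfun_set0.
have [lam_decr lam0 _] := fitlam.
rewrite alternant_staircase_rec (@alternant_branch _ x c) // tab_genfun_branch //.
rewrite -mulrA; congr (_ * _); rewrite mulr_sumr; apply: eq_bigr => mu inter;
  have fitmu := interlace_fits_box fitlam inter.
rewrite card_young_diagram_interlace // mulrCA; congr (_ * _).
by apply: IHN; rewrite ?zero_ext_out.
Qed.

Lemma tab_genfun_last0 D N : left_justified D -> x N = 0 ->
  tab_genfun D N.+1 = tab_genfun D N.
Proof.
move=> leftD xN0; rewrite /tab_genfun (bigID (fun T => tab_shape N T == D)) /=.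
rewrite [X in _ + X]big1 ?addr0.
  under eq_bigl do rewrite -andbA.
  by rewrite tab_genfun_strip // setDv cards0 mul1r.
move=> T /andP[/andP[_ /eqP shT] shT'].
have [p pD pT] : exists2 p, p \in D & T p = N :> nat.
  have : ~~ (D \subset tab_shape N T).
    apply: contra shT' => sDT; rewrite eqEsubset sDT andbT; apply/subsetP=> p.
    by rewrite -shT !inE; lia.
  case/subsetPn=> p pD; rewrite inE -leqNgt => leN; exists p => //.
  by move: pD; rewrite -shT inE; lia.
by rewrite (bigD1 p) //= pT xN0 mul0r.
Qed.

End GenFun.

End Tableaux.

(** * Schur functions *)

Section SchurTableaux.
Variables (K : fieldType) (l : seq nat) (N : nat).
Local Notation box := ('I_(size l) * 'I_(head 0%N l))%type.
Local Notation lshape := (@young_diagram (size l) (head 0%N l) (nth 0%N l)).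

Definition xvar (i : nat) : {mpoly K[N]} := oapp (fun k : 'I_N => 'X_k) 0 (insub i).

Lemma xvarE (i : 'I_N) : xvar i = 'X_i.
Proof. by rewrite /xvar valK. Qed.

Lemma xvar_out i : (N <= i)%N -> xvar i = 0.
Proof. by move=> leNi; rewrite /xvar insubF // ltnNge leNi. Qed.

Implicit Types (T : {ffun cell l -> 'I_N}) (S : {ffun box -> 'I_N.+1}).

Definition tab_of_cells T : {ffun box -> 'I_N.+1} :=
  [ffun p => if insub p is Some q then inord (T q) else ord_max].

Lemma tab_of_cells_val T (q : cell l) : tab_of_cells T (val q) = T q :> nat.
Proof. by rewrite ffunE valK inordK // ltnW // ltnS ltn_ord. Qed.

Lemma tab_of_cells_in T (p : box) (pD : (p.2 < nth 0%N l p.1)%N) :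
  tab_of_cells T p = T (Sub p pD) :> nat.
Proof. by rewrite -[in LHS](SubK (cell l) pD) tab_of_cells_val. Qed.

Lemma tab_of_cells_out T p : p \notin lshape -> tab_of_cells T p = N :> nat.
Proof. by rewrite inE => pD; rewrite ffunE insubN. Qed.

Lemma tab_of_cells_inj : injective tab_of_cells.
Proof.
move=> T1 T2 eqT; apply/ffunP=> q; apply: ord_inj.
by rewrite -!tab_of_cells_val eqT.
Qed.

Lemma tab_shape_of_cells T : tab_shape N (tab_of_cells T) = lshape.
Proof.
apply/setP=> p; rewrite [LHS]inE; have [pD|pD] := boolP (p \in lshape); last first.
  by rewrite tab_of_cells_out // ltnn.
by move: pD; rewrite inE => pD; rewrite (tab_of_cells_in T pD) ltn_ord.
Qed.

Lemma tab_valid_of_cells T : tab_valid (tab_of_cells T) = is_ssyt T.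
Proof.
apply/tab_validP/forallP => [[rowT colT] p|ssT].
  apply/forallP=> q; case Ep : (val p) => [i j]; case Eq : (val q) => [i' j'].
  rewrite -!tab_of_cells_val Ep Eq; apply/andP; split; apply/implyP => /andP[/eqP].
    by move=> <- /rowT.
  by move=> <- lti; apply: colT => //; rewrite -Ep tab_of_cells_val.
split=> [i j j' lej|i i' j lti].
  have [pD|/tab_of_cells_out->] := boolP ((i, j') \in lshape);
    last by rewrite -ltnS ltn_ord.
  have pD' : (j' < nth 0%N l i)%N by move: pD; rewrite inE.
  have pD1 : (j < nth 0%N l i)%N := leq_ltn_trans lej pD'.
  rewrite (tab_of_cells_in T (p := (i, j)) pD1)
    (tab_of_cells_in T (p := (i, j')) pD').
  have /forallP/(_ (Sub (i, j') pD')) := ssT (Sub (i, j) pD1).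
  by rewrite !SubK /= eqxx lej => /andP[].
have [pD _|/tab_of_cells_out->] := boolP ((i, j) \in lshape); last by rewrite ltnn.
have pD1 : (j < nth 0%N l i)%N by move: pD; rewrite inE.
rewrite (tab_of_cells_in T (p := (i, j)) pD1).
have [qD|/tab_of_cells_out->] := boolP ((i', j) \in lshape); last exact: ltn_ord.
have qD1 : (j < nth 0%N l i')%N by move: qD; rewrite inE.
rewrite (tab_of_cells_in T (p := (i', j)) qD1).
have /forallP/(_ (Sub (i', j) qD1)) := ssT (Sub (i, j) pD1).
by rewrite !SubK /= eqxx lti => /andP[].
Qed.

Lemma tab_of_cells_surj S : tab_shape N S = lshape -> exists T, S = tab_of_cells T.
Proof.
move=> shS; have SN (q : cell l) : (S (val q) < N)%N.
  by have /setP/(_ (val q)) := shS; rewrite !inE => ->; apply: (valP q).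
exists [ffun q => Ordinal (SN q)]; apply/ffunP=> p; apply: ord_inj.
have [|pD] := boolP (p \in lshape).
  by rewrite inE => pD; rewrite (tab_of_cells_in _ pD) ffunE
    -[in LHS](SubK (cell l) pD).
rewrite tab_of_cells_out //; move: pD; rewrite -shS inE -leqNgt => leNS.
by apply/eqP; rewrite eqn_leq leNS andbT -ltnS ltn_ord.
Qed.

Lemma schur_tab_genfun : schur K l N = tab_genfun xvar lshape N.
Proof.
have -> : tab_genfun xvar lshape N =
    \sum_(S in tab_of_cells @: [set T | is_ssyt T]) \prod_(p in lshape) xvar (S p).
  apply: eq_bigl => S; apply/andP/imsetP => [[validS /eqP shS]|[T + ->]].
    have [T ST] := tab_of_cells_surj shS; exists T => //.
    by rewrite inE -tab_valid_of_cells -ST.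
  by rewrite inE tab_valid_of_cells tab_shape_of_cells eqxx.
rewrite big_imset /=; last by move=> T1 T2 _ _; apply: tab_of_cells_inj.
apply: eq_big => [T|T _]; first by rewrite inE.
rewrite (reindex_omap (fun q : cell l => val q) insub) /= => [|p]; last first.
  by rewrite inE => pD; rewrite insubT.
apply: eq_big => [q|q _]; last by rewrite tab_of_cells_val xvarE.
by rewrite inE (valP q) valK eqxx.
Qed.

End SchurTableaux.

Section Schur.
Variable K : fieldType.
Implicit Types (l : seq nat).

Lemma nth_sorted_geq l i : sorted geq l -> (nth 0 l i.+1 <= nth 0 l i)%N.
Proof.
move=> sortl; have [lti|le] := ltnP i.+1 (size l); last by rewrite nth_default.
by apply: (sorted_ltn_nth (rev_trans leq_trans)) => //; rewrite inE ltnW.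
Qed.

Lemma sorted_geq_fits_box l : sorted geq l ->
  fits_box (size l) (head 0%N l) (nth 0%N l).
Proof.
by move=> sortl; split=> [i||]; rewrite ?nth_sorted_geq ?nth0 ?nth_default.
Qed.

Lemma schur_bialternant l N : sorted geq l -> (size l <= N)%N ->
  alternant (xvar K N) N (staircase N) * schur K l N =
  alternant (xvar K N) N (fun j => nth 0 l j + staircase N j)%N.
Proof.
move=> sortl leN; rewrite schur_tab_genfun; apply: tab_bialternant;
  last by rewrite nth_default.
exact: sorted_geq_fits_box.
Qed.

Lemma schur_eq0 l N : sorted geq l -> 0%N \notin l -> (N < size l)%N ->
  schur K l N = 0.
Proof.
move=> sortl l0 ltN; rewrite schur_tab_genfun.
have lt0 : (0 < head 0 l)%N.
  by case: l l0 ltN {sortl} => // k l'; rewrite inE negb_or eq_sym -lt0n => /andP[].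
apply: (tab_genfun_eq0 _ (p := (Ordinal ltN, Ordinal lt0))) => //;
  first exact: sorted_geq_fits_box.
by rewrite inE /= lt0n; apply: contra l0 => /eqP <-; apply: mem_nth.
Qed.

Lemma drop_last_xvar N i : drop_last_var (xvar K N.+1 i) = xvar K N i.
Proof.
rewrite /drop_last_var; have [lti|lei] := ltnP i N.+1; last first.
  by rewrite !xvar_out ?rmorph0 // ltnW.
rewrite (xvarE K (Ordinal lti)) comp_mpolyXU -tnth_nth tnth_mktuple.
case: unliftP => [j /(congr1 val) /= ->|/(congr1 val) /= ->];
  last by rewrite xvar_out.
by rewrite /bump leqNgt ltn_ord xvarE.
Qed.

Lemma drop_last_var_schur l N : drop_last_var (schur K l N.+1) = schur K l N.
Proof.
rewrite !schur_tab_genfun -[RHS]tab_genfun_last0; last 2 first.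
- exact: left_justified_young_diagram.
- by rewrite xvar_out.
rewrite /tab_genfun /drop_last_var rmorph_sum; apply: eq_bigr => T _.
by rewrite rmorph_prod; apply: eq_bigr => p _; apply: drop_last_xvar.
Qed.

Lemma card_cell l : sorted geq l -> #|cell l| = sumn l.
Proof.
move=> sortl; rewrite card_sig sumnE (big_nth 0%N) big_mkord.
rewrite -(card_young_diagram (sorted_geq_fits_box sortl)) ?nth_default //.
by apply: eq_card => p; rewrite !inE.
Qed.

Lemma dhomog_schur l N : sorted geq l -> schur K l N \is (sumn l).-homog.
Proof.
move=> sortl; apply: rpred_sum => T _.
rewrite mprodXE dhomogX /= mdeg_sum (eq_bigr (fun=> 1%N)) => [|p _];
  last exact: mdeg1.
by rewrite sum1_card card_cell.
Qed.

Lemma alternant_xvarE N (v : nat -> nat) : alternant (xvar K N) N v =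
  \sum_(s : 'S_N) (-1) ^+ s *: 'X_[[multinom v (s i) | i < N]].
Proof.
rewrite /alternant /determinant; apply: eq_bigr => s _.
rewrite -mul_mpolyC rmorphXn rmorphN rmorph1; congr (_ * _).
rewrite [RHS]mpolyXE_id; apply: eq_bigr => i _.
by rewrite !mxE xvarE mnmE.
Qed.

Lemma msym_alternant N (v : nat -> nat) (s : 'S_N) :
  msym s (alternant (xvar K N) N v) = (-1) ^+ s * alternant (xvar K N) N v.
Proof.
rewrite /alternant -[LHS](det_map_mx (msym s)) -det_perm -det_mulmx -row_permE.
congr (\det _); apply/matrixP=> i j; rewrite !mxE rmorphXn /= !xvarE.
by rewrite /msym mmapX mmap1U.
Qed.

Definition strict_decr N (v : nat -> nat) :=
  forall i j, (i < j)%N -> (j < N)%N -> (v j < v i)%N.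

Lemma strict_decr_staircase N : strict_decr N (staircase N).
Proof. by move=> i j; rewrite /staircase; lia. Qed.

Lemma strict_decr_add_staircase N l : sorted geq l ->
  strict_decr N (fun j => nth 0 l j + staircase N j)%N.
Proof.
move=> sortl i j ltij ltjN; rewrite -addnS leq_add ?strict_decr_staircase //.
exact: fits_box_anti (sorted_geq_fits_box sortl) (ltnW ltij).
Qed.

Lemma increasing_perm1 N (s : 'S_N) :
  (forall i j : 'I_N, (i < j)%N -> (s i < s j)%N) -> s = 1%g.
Proof.
have ge_id (t : 'S_N) : (forall i j : 'I_N, (i < j)%N -> (t i < t j)%N) ->
    forall i : 'I_N, (i <= t i)%N.
  move=> incr [i]; elim: i => // i IHi ltiN /=.
  apply: leq_ltn_trans (IHi (ltnW ltiN)) _.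
  exact: incr.
move=> incr; apply/permP=> i; rewrite perm1; apply: ord_inj; apply/eqP.
rewrite eqn_leq ge_id // andbT; rewrite -[X in (_ <= nat_of_ord X)%N](permK s i).
apply: ge_id => {}i j ltij; rewrite ltnNge; apply/negP;
  rewrite leq_eqVlt => /orP[/eqP|].
  by move/ord_inj/perm_inj => eij; rewrite eij ltnn in ltij.
by move/incr; rewrite !permKV ltnNge ltnW.
Qed.

End Schur.

Section SchurCoefficients.
Variable K : fieldType.
Implicit Types (l : seq nat).

Lemma mcoeff_alternant N (v w : nat -> nat) :
    strict_decr N v -> strict_decr N w ->
  (alternant (xvar K N) N v)@_[multinom w i | i < N] =
    [forall i : 'I_N, v i == w i]%:R.
Proof.
move=> dv dw; rewrite alternant_xvarE raddf_sum (bigD1 1%g) //= big1 ?addr0;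
  last first.
  move=> s neq; rewrite mcoeffZ mcoeffX; case: eqP => [/mnmP vw|_];
    last by rewrite mulr0.
  case/eqP: neq; apply: increasing_perm1 => i j ltij; rewrite ltnNge; apply/negP.
  have := dw i j ltij (ltn_ord j); have := vw i; have := vw j;
    rewrite !mnmE => <- <- ltv.
  rewrite leq_eqVlt => /orP[/eqP sij|/dv]; first by rewrite sij ltnn in ltv.
  by move/(_ (ltn_ord _)); rewrite ltnNge ltnW.
rewrite mcoeffZ mcoeffX odd_perm1 mul1r; congr (_ : bool)%:R.
apply/eqP/forallP => [/mnmP vw i|vw].
  by have := vw i; rewrite !mnmE perm1 => ->.
by apply/mnmP=> i; rewrite !mnmE perm1; apply/eqP/vw.
Qed.

Lemma alternant_staircase_neq0 N : alternant (xvar K N) N (staircase N) != 0.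
Proof.
apply/eqP=> /(congr1 (mcoeff [multinom staircase N i | i < N])).
rewrite (mcoeff_alternant (@strict_decr_staircase N) (@strict_decr_staircase N))
  mcoeff0.
by rewrite (introT forallP) => [/eqP|//]; rewrite oner_eq0.
Qed.

Lemma schur_sym l N : sorted geq l -> 0%N \notin l -> schur K l N \is symmetric.
Proof.
move=> sortl l0; have [leN|ltN] := leqP (size l) N;
  last by rewrite schur_eq0 ?rpred0.
apply/issymP=> s; apply: (mulfI (alternant_staircase_neq0 N)).
have sign_neq0 : (-1) ^+ s != 0 :> {mpoly K[N]} by rewrite signr_eq0.
apply: (mulfI sign_neq0); rewrite mulrA -msym_alternant -msymM schur_bialternant //.
by rewrite msym_alternant.
Qed.

Lemma homog_symfun_schur n l : l \in partns n -> homog_symfun n (schur K l).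
Proof.
rewrite mem_partns => /and3P[sortl l0 /eqP <-]; split=> N.
- exact: schur_sym.
- exact: dhomog_schur.
exact: drop_last_var_schur.
Qed.

Lemma eq_from_nth0 l l' : 0%N \notin l -> 0%N \notin l' ->
  nth 0%N l =1 nth 0%N l' -> l = l'.
Proof.
have size_le k k' : 0%N \notin k -> nth 0%N k =1 nth 0%N k' ->
  (size k <= size k')%N.
  move=> k0 eqk; rewrite leqNgt; apply/negP => /(mem_nth 0%N).
  by rewrite eqk nth_default // (negPf k0).
move=> l0 l0' eql; apply: (eq_from_nth (x0 := 0%N)) => //.
by apply/eqP; rewrite eqn_leq !size_le.
Qed.

Definition mnm_add_staircase l N : 'X_{1..N} :=
  [multinom (nth 0 l i + staircase N i)%N | i < N].

Lemma mcoeff_staircase_schur m n l l' N :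
    is_partn m l -> is_partn n l' -> (size l <= N)%N ->
  (alternant (xvar K N) N (staircase N) * schur K l' N)@_(mnm_add_staircase l N) =
    (l' == l)%:R.
Proof.
move=> /and3P[sortl l0 _] /and3P[sortl' l0' _] leN.
have [leN'|ltN] := leqP (size l') N; last first.
  rewrite schur_eq0 // mulr0 mcoeff0; case: eqP => // ll'.
  by rewrite ll' ltnNge leN in ltN.
rewrite schur_bialternant //.
rewrite (mcoeff_alternant (strict_decr_add_staircase sortl')
  (strict_decr_add_staircase sortl)).
congr (_ : bool)%:R; apply/forallP/eqP => [eql|-> //].
apply: eq_from_nth0 => // i; have [ltiN|leNi] := ltnP i N.
  by have := eql (Ordinal ltiN); rewrite /= eqn_add2r => /eqP.
by rewrite !nth_default ?(leq_trans _ leNi).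
Qed.

Lemma schur_expansion_coef n f c l N :
    is_expansion (@schur K) n f c -> l \in partns n -> (size l <= N)%N ->
  c l = (alternant (xvar K N) N (staircase N) * f N)@_(mnm_add_staircase l N).
Proof.
move=> expc ln leN; rewrite expc mulr_sumr raddf_sum /= big_seq.
under eq_bigr => l' l'n.
  rewrite -scalerAr mcoeffZ (@mcoeff_staircase_schur n n) -?mem_partns //.
  over.
by rewrite -big_seq sum_uniq_eq ?partns_uniq.
Qed.

End SchurCoefficients.

(** * The bases of Schur and complete symmetric functions *)

Section ExchangeBases.
Variables (K : fieldType) (V : lmodType K) (I : eqType) (r : seq I).
Hypothesis uniq_r : uniq r.
Implicit Types B : I -> V.

Definition free_on B := forall c, \sum_(i <- r) c i *: B i = 0 ->
  {in r, forall i, c i = 0}.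

Let d := size r.
Let row_of (c : I -> K) : 'rV[K]_d := \row_k c (tnth (in_tuple r) k).
Let fun_of (v : 'rV[K]_d) (i : I) : K :=
  if insub (index i r) is Some k then v 0 k else 0.

Let fun_of_tnth v k : fun_of v (tnth (in_tuple r) k) = v 0 k.
Proof.
by rewrite /fun_of (tnth_nth (tnth (in_tuple r) k)) index_uniq ?ltn_ord //= valK.
Qed.

Let row_ofP c i : i \in r -> exists k, c i = row_of c 0 k.
Proof. by case/seq_tnthP=> k ->; exists k; rewrite mxE. Qed.

(* The transition matrix from a free family to a family of the same size that spans
   it is invertible. *)
Lemma exchange_bases (s h : I -> V) (M : I -> I -> K) :
    {in r, forall i, s i = \sum_(j <- r) M i j *: h j} -> free_on s ->
  free_on h /\
  (forall c, exists e, \sum_(i <- r) c i *: h i = \sum_(i <- r) e i *: s i).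
Proof.
move=> sE free_s; pose trans :=
  \matrix_(i < d, j < d) M (tnth (in_tuple r) i) (tnth (in_tuple r) j).
have sumE B (c : I -> K) : \sum_(i <- r) c i *: B i =
  \sum_k row_of c 0 k *: B (tnth (in_tuple r) k).
  by rewrite [LHS](big_tnth _ _ r); apply: eq_bigr => k _; rewrite mxE.
have sum_s v : \sum_(i <- r) fun_of v i *: s i =
  \sum_j (v *m trans) 0 j *: h (tnth (in_tuple r) j).
  rewrite sumE; under [RHS]eq_bigr do rewrite mxE scaler_suml.
  rewrite [RHS]exchange_big; apply: eq_bigr => k _ /=.
  rewrite mxE fun_of_tnth sE ?mem_tnth // sumE scaler_sumr.
  by apply: eq_bigr => j _; rewrite !mxE scalerA.
have unit_trans : trans \in unitmx.
  rewrite -row_free_unit; apply: inj_row_free => v v_trans0; apply/rowP=> k;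
    rewrite mxE.
  rewrite -(fun_of_tnth v k); apply: free_s; last exact: mem_tnth.
  by rewrite sum_s v_trans0 big1 // => j _; rewrite mxE scale0r.
have sum_h c : \sum_(i <- r) c i *: h i =
  \sum_(i <- r) fun_of (row_of c *m invmx trans) i *: s i.
  by rewrite [RHS]sum_s mulmxKV // sumE.
split=> [c c0 i ri|c]; last by eexists; apply: sum_h.
have coord0 : row_of c *m invmx trans = 0.
  apply/rowP=> k; rewrite [RHS]mxE -fun_of_tnth.
  by apply: free_s; last exact: mem_tnth; rewrite -sum_h.
have [k ->] := row_ofP c ri.
by rewrite -(mulmxKV unit_trans (row_of c)) coord0 mul0mx mxE.
Qed.

End ExchangeBases.

Section Bases.
Variable K : fieldType.
Implicit Types (f : varfam K) (l : seq nat).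

Lemma bcoef_expansion (B : seq nat -> varfam K) n f :
  (exists c, is_expansion B n f c) -> is_expansion B n f (bcoef B n f).
Proof. exact: epsilon_spec. Qed.

Lemma hfun_expansion n f : homog_symfun n f ->
  is_expansion (@hfun K) n f (bcoef (@hfun K) n f).
Proof.
move=> homf; have [symf degf _] := homf; apply: bcoef_expansion.
have [c fnE] := symmetric_hfun_span (symf n) (degf n); exists c.
exact: is_expansion_homog homf (@homog_symfun_hfun_partns K n) fnE.
Qed.

Lemma schur_free n : free_on (partns n) (fun l => schur K l n).
Proof.
move=> c c0 l ln; have exp0 : is_expansion (@schur K) n (fun N => 0) c.
  apply: is_expansion_homog (@homog_symfun_schur K n) (esym c0).
  by split=> N; rewrite ?rpred0 // /drop_last_var raddf0.
have sizel : (size l <= n)%N.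
  by move: ln; rewrite mem_filter => /andP[_ /mapP[t _ ->]];
    rewrite size_map size_bseq.
by rewrite (schur_expansion_coef exp0 ln sizel) mulr0 mcoeff0.
Qed.

Lemma hfun_free_schur_span n :
  free_on (partns n) (fun l => hfun K l n) /\
  (forall c, exists e, \sum_(l <- partns n) c l *: hfun K l n =
                       \sum_(l <- partns n) e l *: schur K l n).
Proof.
apply: (exchange_bases (partns_uniq n) _ (@schur_free n)) => l ln.
exact: (hfun_expansion (homog_symfun_schur K ln)).
Qed.

Lemma schur_expansion n f :
  homog_symfun n f -> is_expansion (@schur K) n f (bcoef (@schur K) n f).
Proof.
move=> homf; apply: bcoef_expansion; have [_ span_s] := hfun_free_schur_span n.
have [e fnE] := span_s (bcoef (@hfun K) n f); exists e.
apply: (is_expansion_homog homf (@homog_symfun_schur K n)).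
by rewrite -fnE; apply: hfun_expansion.
Qed.

Lemma bcoef_hfunE n f c : is_expansion (@hfun K) n f c ->
  {in partns n, bcoef (@hfun K) n f =1 c}.
Proof.
move=> expc l ln; have expb := bcoef_expansion (ex_intro _ c expc).
have [free_h _] := hfun_free_schur_span n.
apply/eqP; rewrite -subr_eq0; apply/eqP.
apply: (free_h (fun l => bcoef (@hfun K) n f l - c l)) ln.
by under eq_bigr do rewrite scalerBl; rewrite sumrB -expb -expc subrr.
Qed.

End Bases.

(** * Coefficients in the basis of complete symmetric functions *)

Section SpecialTwists.
Variable K : fieldType.
Implicit Types b q w : fps K.

Lemma fps_twist_1DXn b k n : (0 < k)%N ->
  fps_twist idfun b (fun m => ((m == 0%N) || (m == k))%:R) (k * n) =
  fps_exp (fps_opp (fps_dil (-1) (fps_logser (fun i => b (k * i)%N)))) n.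
Proof.
move=> k_gt0; set eta : fps K := fun m => _.
have etaE : eta - 1 = fps_substX k (fps_X K).
  apply: funext => m; rewrite fps_coefB fps_coef1 /eta /fps_substX /fps_X.
  have [->|m_gt0] := posnP m; first by rewrite dvdn0 div0n subrr.
  rewrite subr0 /=; case: ifP => [km|].
    by rewrite -[in RHS](eqn_pmul2r k_gt0) divnK // mul1n.
  by case: eqP => // ->; rewrite dvdnn.
have logE : fps_logA idfun eta = fps_substX k (log_coef K).
  by rewrite /fps_logA etaE -fps_substX_comp // fps_comp_X.
pose g : fps K := fun i => b (k * i)%N * log_coef K i.
have hadamardE : fps_hadamard idfun b (fps_logA idfun eta) = fps_substX k g.
  apply: funext => m; rewrite /fps_hadamard logE /fps_substX /g /=.
  by case: ifP => [/divnK km|]; rewrite ?mulr0 // mulnC km.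
rewrite /fps_twist hadamardE -[fps_expA _ _]fps_substX_comp ?fps_coef_substX //;
  last first.
  by rewrite /g mulr0.
congr (fps_exp _ n); apply: funext => -[|i]; rewrite /g /fps_opp /fps_dil /=.
  by rewrite !mulr0 oppr0.
by rewrite exprS mulN1r mulNr opprK mulrCA.
Qed.

Lemma fps_expA_coefX2 (f : fps {poly K}) n : f 0%N = 0 ->
  (fps_expA (@polyC K) (fps_scale 'X f) n)`_2 =
    (f n)`_1 + (fps_map (coefp 0) f ^+ 2) n / 2%:R.
Proof.
move=> f0; rewrite /fps_expA (@fps_comp_scale _ _ _ _ _ n.+3) ?ltnS ?leqW //.
rewrite coef_sum.
under eq_bigr do rewrite -mulrA coefCM coefXnM.
rewrite 3!big_ord_recl big1 /= => [|m _]; last by rewrite mulr0.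
rewrite expr0 expr1 fps_coef1 -polyC_natr coefC mulr0 add0r addr0 /exp_coef.
rewrite invr1 mul1r mulrC; congr (_ + _ / _).
by have -> : fps_map (coefp 0) f ^+ 2 = fps_map (coefp 0) (f ^+ 2)
  by rewrite rmorphXn.
Qed.

Lemma fps_logA_coefX (f : fps K) m n : f 0%N = 0 ->
  (fps_logA (@polyC K) (1 + fps_scale 'X (fps_map (@polyC K) f)) n)`_m =
  log_coef K m * (f ^+ m) n.
Proof.
move=> f0; have f0' : fps_map (@polyC K) f 0%N = 0 by rewrite /fps_map f0.
rewrite /fps_logA [1 + _]addrC addrK (@fps_comp_scale _ _ _ _ _ (maxn m n).+1)
  ?ltnS ?leq_maxr //.
rewrite coef_sum (bigD1 (inord m)) //= inordK ?ltnS ?leq_maxl // big1 => [|k].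
  by rewrite addr0 -mulrA coefCM coefXnM ltnn subnn -rmorphXn /fps_map coefC.
rewrite -val_eqE /= inordK ?ltnS ?leq_maxl // => neq.
rewrite -mulrA coefCM coefXnM -rmorphXn /fps_map coefC subn_eq0.
by case: (ltngtP m k) neq => //= _ _; rewrite mulr0.
Qed.

Lemma fps_twist_coefX2 b q n : q 0%N = 0 ->
  (fps_twist (@polyC K) b (1 + fps_scale 'X (fps_map (@polyC K) q)) n)`_2 =
  ((fps_hadamard idfun b q ^+ 2) n - b n * (q ^+ 2) n) / 2%:R.
Proof.
move=> q0; set eta := 1 + _.
pose L : fps {poly K} := fun n => b n *: drop_poly 1 (fps_logA (@polyC K) eta n).
have hadamardE : fps_hadamard (@polyC K) b (fps_logA (@polyC K) eta) =
  fps_scale 'X L.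
  apply: funext => m; apply/polyP=> s; rewrite /fps_hadamard /fps_scale /L.
  rewrite coefCM coefXM coefZ coef_drop_poly; case: s => [|s];
    last by rewrite addn1.
  by rewrite fps_logA_coefX // mul0r mulr0.
have LE m s : (L m)`_s = b m * (log_coef K s.+1 * (q ^+ s.+1) m).
  by rewrite coefZ coef_drop_poly addn1 fps_logA_coefX.
have L0 : L 0%N = 0.
  by apply/polyP=> s; rewrite LE exprS fps_coef0M q0 mul0r !mulr0 coef0.
rewrite /fps_twist hadamardE fps_expA_coefX2 // LE.
have -> : fps_map (coefp 0) L = fps_hadamard idfun b q.
  by apply: funext => m; rewrite /fps_map /= LE /log_coef divr1 !mul1r.
by rewrite /log_coef expr1; ring.
Qed.

Lemma sqr_hadamard_two_terms w i j : let q := fun m => ((m == i) || (m == j))%:R in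
  (fps_hadamard idfun w q ^+ 2) (i + j)%N =
    if i == j then w i ^+ 2 else w i * w j *+ 2.
Proof.
move=> q; rewrite expr2 fps_coefM.
have iP : (i < (i + j).+1)%N by rewrite ltnS leq_addr.
have jP : (j < (i + j).+1)%N by rewrite ltnS leq_addl.
have q_eq0 (u : nat) : u != i -> u != j -> q u = 0.
  by rewrite /q => /negPf-> /negPf->.
rewrite (bigD1 (Ordinal iP)) //= addKn /fps_hadamard {1 2}/q !eqxx orbT !mulr1.
have [eq_ij|neq_ij] := eqVneq i j.
  rewrite big1 ?addr0 => [|u]; first by rewrite -eq_ij.
  rewrite -val_eqE /= => u_neq_i; have u_neq_j : u != j :> nat by lia.
  by rewrite (q_eq0 u) // mulr0 mul0r.
rewrite (bigD1 (Ordinal jP)) /=; last by rewrite -val_eqE /= eq_sym.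
rewrite addnK {1 2}/q !eqxx orbT !mulr1 big1 ?addr0 => [|u].
  by rewrite [w j * _]mulrC.
by rewrite -!val_eqE /= => /andP[u_neq_i u_neq_j]; rewrite (q_eq0 u) // mulr0 mul0r.
Qed.

End SpecialTwists.

Lemma nseq_in_partns k n : (0 < k)%N -> nseq n k \in partns (k * n).
Proof.
move=> k_gt0; rewrite mem_partns /is_partn sumn_nseq eqxx andbT.
rewrite mem_nseq ltn_eqF // andbF andbT.
by case: n => // n /=; elim: n => //= n ->; rewrite /geq /= leqnn.
Qed.

Lemma prod_eq_nseq_partns (A : comNzRingType) k n l :
    (0 < k)%N -> l \in partns (k * n) ->
  \prod_(j <- l) ((j == 0%N) || (j == k))%:R = (l == nseq n k)%:R :> A.
Proof.
move=> k_gt0; rewrite mem_partns => /and3P[_ l0 /eqP suml].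
have [/all_pred1P lE|] := boolP (all (pred1 k) l).
  have size_l : size l = n.
    by move: suml; rewrite {1}lE sumn_nseq => /eqP; rewrite eqn_pmul2l // => /eqP.
  by rewrite lE size_l eqxx big_seq big1 // => j /nseqP[-> _]; rewrite eqxx orbT.
move=> /allPn[j lj /= /negPf jk]; rewrite (big_rem j lj) /= jk orbF.
have -> : (j == 0%N) = false by apply: contraNF l0 => /eqP <-.
by rewrite mul0r; case: eqP lj => // ->; rewrite mem_nseq jk andbF.
Qed.

Lemma coef2_prod_two_parts (K : fieldType) (i j n : nat) l :
    (0 < i)%N -> (0 < j)%N -> (i + j)%N = n -> l \in partns n ->
  (\prod_(k <- l)
     ((k == 0%N)%:R + 'X * (((k == i) || (k == j))%:R)%:P) : {poly K})`_2 =
  (l == [:: maxn i j; minn i j])%:R.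
Proof.
move=> i_gt0 j_gt0 ijn; rewrite mem_partns => /and3P[sortl l0 /eqP suml].
pose q k : K := ((k == i) || (k == j))%:R.
have -> : \prod_(k <- l) ((k == 0%N)%:R + 'X * (q k)%:P) =
  (\prod_(k <- l) q k) *: 'X^(size l).
  elim: l l0 {sortl suml} => [|k l IHl]; first by rewrite !big_nil scale1r.
  rewrite inE negb_or eq_sym => /andP[/negPf k0 l0];
    rewrite !big_cons IHl // k0 add0r.
  by rewrite exprS -!mul_polyC polyCM; ring.
rewrite coefZ coefXn; case: l sortl l0 suml => [|x [|y [|z l]]] sortl l0 suml;
  rewrite ?mulr0 ?eqseq_cons ?andbF //=.
rewrite mulr1 !big_cons big_nil mulr1 /q -mulnb -natrM; congr (_%:R).
move: sortl l0 suml; rewrite /= !inE /= /geq /= addn0 !andbT => lexy.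
rewrite negb_or => /andP[x0 y0] sumxy; lia.
Qed.

Section HfunCoefficients.
Variable K : fieldType.
Hypothesis charK0 : [pchar K] =i pred0.
Variables (a b : fps K).
Hypothesis a0 : a 0%N = 1.
Hypothesis log_a : forall n, (0 < n)%N -> fps_log a n = b n / n%:R.

(* Specializing h_k to eta_k for all k. *)
Lemma Rfun_specialization (A : comNzRingType) (iota : {rmorphism K -> A})
    (eta : fps A) n :
    eta 0%N = 1 ->
  fps_twist iota b eta n =
  \sum_(l <- partns n) iota (bcoef (@hfun K) n (Rfun a n) l) * \prod_(k <- l) eta k.
Proof.
move=> eta0; have [c expc ->] // := Rfun_hfun_expansion charK0 n a0 log_a.
rewrite big_seq [RHS]big_seq; apply: eq_bigr => l ln.
by rewrite (bcoef_hfunE expc).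
Qed.

Lemma bcoef_hfun_rect k n : (0 < k)%N ->
  bcoef (@hfun K) (k * n) (Rfun a (k * n)) (nseq n k) =
  fps_exp (fps_opp (fps_dil (-1) (fps_logser (fun i => b (k * i)%N)))) n.
Proof.
move=> k_gt0; rewrite -fps_twist_1DXn // Rfun_specialization //= big_seq.
under eq_bigr => l ln do rewrite (prod_eq_nseq_partns _ k_gt0 ln).
by rewrite -big_seq sum_uniq_eq ?partns_uniq ?nseq_in_partns.
Qed.

Lemma bcoef_hfun_two i j n : (0 < i)%N -> (0 < j)%N -> (i + j)%N = n ->
  bcoef (@hfun K) n (Rfun a n) [:: maxn i j; minn i j] =
  if i == j then (b i ^+ 2 - b n) / 2%:R else b i * b j - b n.
Proof.
move=> i_gt0 j_gt0 ijn; pose q : fps K := fun m => ((m == i) || (m == j))%:R.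
pose eta := 1 + fps_scale 'X (fps_map (@polyC K) q).
have q0 : q 0%N = 0 by rewrite /q !ltn_eqF.
have eta0 : eta 0%N = 1.
  by rewrite /eta fps_coefD /fps_scale /fps_map q0 mulr0 addr0.
have two_parts : [:: maxn i j; minn i j] \in partns n.
  by rewrite mem_partns /is_partn /= !inE /geq /=; lia.
have := congr1 (coefp 2) (Rfun_specialization (@polyC K) n eta0).
rewrite /= fps_twist_coefX2 // coef_sum big_seq.
under eq_bigr => l ln do rewrite coefCM (coef2_prod_two_parts K i_gt0 j_gt0 ijn ln).
rewrite -big_seq sum_uniq_eq ?partns_uniq // => <-.
have hadamard1 : q = fps_hadamard idfun (fun=> 1) q.
  by apply: funext => m; rewrite /fps_hadamard mul1r.
rewrite [in X in _ - X]hadamard1 -ijn !sqr_hadamard_two_terms.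
have two_neq0 := natrS_neq0 charK0 1.
by case: eqP => _; [rewrite expr1n mulr1|field].
Qed.

End HfunCoefficients.

(** * Coefficients in the basis of Schur functions *)

Section SchurCoefficientsOfR.
Variable K : fieldType.
Implicit Types (a : fps K) (l : seq nat).

Lemma bcoef_schurE n (f : varfam K) l N :
    homog_symfun n f -> l \in partns n -> (size l <= N)%N ->
  bcoef (@schur K) n f l =
  (alternant (xvar K N) N (staircase N) * f N)@_(mnm_add_staircase l N).
Proof. by move=> homf; apply/schur_expansion_coef/schur_expansion. Qed.

Lemma row_partn_in_partns n : row_partn n \in partns n.
Proof.
by rewrite mem_partns; case: n => [|n] //=; rewrite /is_partn /= addn0 eqxx.
Qed.

Lemma bcoef_schur_row n (f : varfam K) : homog_symfun n f ->
  bcoef (@schur K) n f (row_partn n) = (f 1%N)@_[multinom n | i < 1].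
Proof.
move=> homf; rewrite (bcoef_schurE (N := 1) homf (row_partn_in_partns n));
  last by case: (n).
rewrite /alternant det_mx11 mxE expr0 mul1r; congr (_@__).
by apply/mnmP=> i; rewrite !mnmE ord1 addn0; case: (n).
Qed.

Lemma bcoef_schur_row_Rfun a n : a 0%N = 1 ->
  bcoef (@schur K) n (Rfun a n) (row_partn n) = a n.
Proof.
move=> a0; rewrite bcoef_schur_row; last exact: homog_symfun_Rfun.
by rewrite mcoeff_Rfun mdegE !big_ord1 mnmE eqxx.
Qed.

Lemma hfun_one_variable l : hfun K l 1 = 'X_[[multinom sumn l | i < 1]].
Proof.
rewrite /hfun; elim: l => [|k l IHl].
  by rewrite big_nil -mpolyX0; congr 'X_[_]; apply/mnmP=> i; rewrite !mnmE.
rewrite big_cons IHl; have -> : hsym K k 1 = 'X_[[multinom k | i < 1]].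
  apply/mpolyP=> m; rewrite hsymE mcoeff_Rfun mcoeffX big1_eq mdegE big_ord1.
  have -> : ([multinom k | _ < 1] == m) = (m ord0 == k); last by case: eqP.
  apply/eqP/eqP => [<-|mk]; first by rewrite mnmE.
  by apply/mnmP=> i; rewrite mnmE ord1 mk.
by rewrite -mpolyXD; congr 'X_[_]; apply/mnmP=> i; rewrite !mnmE.
Qed.

Lemma bcoef_schur_row_hfun n (f : varfam K) : homog_symfun n f ->
  bcoef (@schur K) n f (row_partn n) = \sum_(l <- partns n) bcoef (@hfun K) n f l.
Proof.
move=> homf; rewrite bcoef_schur_row // (hfun_expansion homf) raddf_sum big_seq
  [RHS]big_seq.
apply: eq_bigr => l; rewrite mem_partns => /and3P[_ _ /eqP <-] /=.
by rewrite mcoeffZ hfun_one_variable mcoeffX eqxx mulr1.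
Qed.

(* a_(m - i), with a vanishing at negative indices. *)
Definition coef_sub a (m i : nat) : K := if (i <= m)%N then a (m - i)%N else 0.

Lemma coef_subSS a m i : coef_sub a m.+1 i.+1 = coef_sub a m i.
Proof. by []. Qed.

Lemma coef_sub0 a m : coef_sub a m 0 = a m.
Proof. by rewrite /coef_sub subn0. Qed.

Lemma mcoeff_mulX_Rfun a n N (m w : 'X_{1..N}) : mdeg w = (n + mdeg m)%N ->
  ('X_[m] * Rfun a n N)@_w = \prod_i coef_sub a (w i) (m i).
Proof.
move=> degw; have [/mnm_lepP lemw|] := boolP (m <= w)%MM.
  have wE : w = (m + (w - m))%MM by rewrite addmC submK //; apply/mnm_lepP.
  rewrite mulrC {1}wE mcoeffMX mcoeff_Rfun.
  move: degw; rewrite {1}wE mdegD addnC => /eqP; rewrite eqn_add2r => ->.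
  by apply: eq_bigr => i _; rewrite /coef_sub lemw mnmE.
move=> nlemw; have [i lt_i] : exists i, (w i < m i)%N.
  apply/existsP; apply: contraR nlemw; rewrite negb_exists => /forallP lemw.
  by apply/mnm_lepP=> i; rewrite leqNgt.
rewrite [RHS](bigD1 i) //= /coef_sub leqNgt lt_i mul0r; apply/eqP.
rewrite mcoeff_eq0 mulrC (perm_mem (msuppMX _ _));
  apply: contra nlemw => /mapP[m' _ ->].
exact: lem_addr.
Qed.

Definition jacobi_trudi a l N : K :=
  \det (\matrix_(i < N, j < N) coef_sub a (nth 0 l i + j)%N i).

Lemma bcoef_schur_Rfun a n l N : a 0%N = 1 -> l \in partns n -> (size l <= N)%N ->
  bcoef (@schur K) n (Rfun a n) l = jacobi_trudi a l N.
Proof.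
move=> a0 ln leN; rewrite (bcoef_schurE (homog_symfun_Rfun n a0) ln leN).
rewrite alternant_xvarE mulr_suml raddf_sum; apply: eq_bigr => s _ /=.
rewrite -scalerAl mcoeffZ; congr (_ * _).
move: ln; rewrite mem_partns => /and3P[_ _ /eqP suml].
rewrite mcoeff_mulX_Rfun => [|]; last first.
  have -> : mdeg [multinom staircase N (s i) | i < N] =
    (\sum_(i < N) staircase N i)%N.
    by rewrite mdegE [RHS](reindex_inj (@perm_inj _ s)); apply: eq_bigr => i _;
      rewrite mnmE.
  rewrite mdegE -suml sumnE (big_nth 0%N) big_mkord
    (@sum_ord_support (nth 0%N l) (size l) N).
  - by rewrite -big_split; apply: eq_bigr => i _; rewrite mnmE.
  - by move=> i lei; rewrite nth_default.
  by move=> i lei; rewrite nth_default // (leq_trans leN).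
apply: eq_bigr => i _; rewrite mxE !mnmE /coef_sub /staircase.
have := ltn_ord i; have := ltn_ord (s i) => ltsi lti.
rewrite (_ : (_ <= _)%N = (i <= nth 0 l i + s i)%N); last by lia.
by case: ifP => // lei; congr a; lia.
Qed.

End SchurCoefficientsOfR.

Section Hooks.
Variables (K : fieldType) (a : fps K).
Hypothesis a0 : a 0%N = 1.

Definition hook_det m k : K := jacobi_trudi a (m :: nseq k 1%N) k.+1.

Definition column_det k : K := jacobi_trudi a (nseq k 1%N) k.

Lemma hook_det0 m : hook_det m 0 = a m.
Proof. by rewrite /hook_det /jacobi_trudi det_mx11 mxE coef_sub0 /= addn0. Qed.

Lemma nth_hook m k i : (i <= k)%N ->
  nth 0%N (m :: nseq k 1%N) i = if i == 0%N then m else 1%N.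
Proof. by case: i => //= i ltik; rewrite nth_nseq ltik. Qed.

(* Only the first two entries of the first column are nonzero. *)
Lemma hook_detS m k : hook_det m k.+1 = a m * column_det k.+1 - hook_det m.+1 k.
Proof.
rewrite {1}/hook_det /jacobi_trudi; set hook_mx := \matrix_(i, j) _.
rewrite (expand_det_col _ ord0) 2!big_ord_recl big1 => [|i _].
  rewrite addr0 ![hook_mx _ _]mxE lift0 !addn0 !nth_hook //.
  rewrite coef_subSS !coef_sub0 a0 mul1r.
  rewrite /cofactor /= expr0 mul1r expr1 mulN1r /column_det /hook_det /jacobi_trudi.
  congr (a m * _ - _); congr (\det _); apply/matrixP=> i j; rewrite !mxE.
    rewrite !lift0 (nth_hook m (ltn_ord i)) -[nseq k.+1 1%N]/(1%N :: nseq k 1%N).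
    by rewrite (nth_hook 1 (leq_ord i)) if_same add1n coef_subSS.
  rewrite !lift0 (nth_hook m.+1 (leq_ord i)) /= /bump.
  case: (i : nat) (leq_ord i) => [|i' lti] /=; first by rewrite addnS.
  by rewrite nth_nseq lti add1n !coef_subSS.
by rewrite mxE !lift0 (nth_hook m (ltn_ord (lift ord0 i))) mul0r.
Qed.

Lemma hook_det_sum m k :
  hook_det m k = \sum_(i < k.+1) (-1) ^+ i * a (m + i)%N * column_det (k - i).
Proof.
elim: k m => [|k IHk] m; rewrite big_ord_recl /= addn0 subn0 mul1r.
  by rewrite hook_det0 big_ord0 addr0 /column_det /jacobi_trudi det_mx00 mulr1.
rewrite hook_detS IHk -sumrN; congr (_ + _); apply: eq_bigr => i _.
by rewrite /bump add1n addnS subSS exprS mulN1r !mulNr.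
Qed.

Lemma mul_column_det m k : a m * column_det k.+1 =
  hook_det m k.+1 + hook_det m.+1 k.
Proof. by rewrite hook_detS subrK. Qed.

Lemma hook_det0S k : hook_det 0 k.+1 = 0.
Proof. by rewrite hook_detS a0 mul1r subrr. Qed.

Lemma column_det_inv : column_det = fps_inv (fps_dil (-1) a).
Proof.
apply: fps_inv_unique; first by rewrite fps_dil_coef0.
apply: funext => k; rewrite fps_coefM -[LHS](hook_det_sum 0).
by case: k => [|k]; [rewrite hook_det0 | rewrite hook_det0S].
Qed.

Lemma hook_series_coef n : (0 < n)%N ->
  \sum_(j < n.+1) (a (n - j)%N * column_det j) *: 'X^j =
  (1 + 'X) * \sum_(k < n) hook_det (n - k) k *: 'X^k.
Proof.
case: n => // n _.
transitivity (\sum_(j < n.+2) hook_det (n.+1 - j) j *: 'X^j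
              + \sum_(j < n.+1) hook_det (n.+1 - j) j *: 'X^(j.+1) : {poly K}).
  rewrite !(big_ord_recl n.+1) /= subn0 hook_det0 /column_det {1}/jacobi_trudi
    det_mx00 mulr1.
  rewrite -addrA; congr (_ + _); rewrite -big_split; apply: eq_bigr => j _ /=.
  by rewrite /bump /= add1n subSS subSn ?leq_ord // -scalerDl -mul_column_det.
rewrite mulrDl mul1r mulr_sumr big_ord_recr /= subnn hook_det0S scale0r addr0;
  congr (_ + _).
by apply: eq_bigr => j _; rewrite -scalerAr exprS.
Qed.

Lemma fps_inv_dilX :
  fps_inv (fps_dil (- 'X) (fps_map (@polyC K) a)) =
  fps_dil 'X (fps_map (@polyC K) (fps_inv (fps_dil (-1) a))).
Proof.
have -> : fps_dil (- 'X) (fps_map (@polyC K) a) =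
  fps_dil 'X (fps_map (@polyC K) (fps_dil (-1) a)).
  apply: funext => n; rewrite /fps_dil /fps_map exprNn rmorphM rmorph_sign -mulrA.
  exact: mulrCA.
apply/esym/fps_inv_unique; first by rewrite fps_dil_coef0 /fps_map fps_dil_coef0 a0.
by rewrite -!rmorphM fps_mulfV ?fps_dil_coef0 // !rmorph1.
Qed.

Lemma mul_inv_dilX_coef n :
  (fps_map (@polyC K) a * fps_inv (fps_dil (- 'X) (fps_map (@polyC K) a))) n =
  \sum_(j < n.+1) (a (n - j)%N * column_det j) *: 'X^j.
Proof.
rewrite fps_inv_dilX -column_det_inv mulrC; apply: eq_bigr => j _.
by rewrite /fps_dil /fps_map -!mul_polyC polyCM; ring.
Qed.

Lemma hook_in_partns n k : (k < n)%N -> ((n - k)%N :: nseq k 1%N) \in partns n.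
Proof.
move=> ltkn; have nk : (0 < n - k)%N by rewrite subn_gt0.
have sorted_hook m h : (0 < m)%N -> sorted geq (m :: nseq h 1%N).
  by elim: h m => //= h IHh m m0; rewrite /geq /= m0 IHh.
rewrite mem_partns /is_partn sorted_hook //= sumn_nseq mul1n subnK 1?ltnW //.
by rewrite eqxx andbT inE negb_or mem_nseq andbF andbT eq_sym -lt0n.
Qed.

Lemma bcoef_schur_hook n k : (k < n)%N ->
  bcoef (@schur K) n (Rfun a n) ((n - k)%N :: nseq k 1%N) = hook_det (n - k) k.
Proof.
move=> /hook_in_partns hook_partn.
by rewrite (bcoef_schur_Rfun (N := k.+1) a0 hook_partn) //= size_nseq.
Qed.

Lemma bcoef_schur_column n :
  bcoef (@schur K) n (Rfun a n) (nseq n 1%N) = fps_inv (fps_dil (-1) a) n.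
Proof.
have column_partn : nseq n 1%N \in partns n.
  by have := nseq_in_partns n (ltn0Sn 0); rewrite mul1n.
by rewrite (bcoef_schur_Rfun (N := n) a0 column_partn) ?size_nseq //
  -column_det_inv.
Qed.

End Hooks.

Theorem theorem2p7 (K : fieldType) (charK0 : [pchar K] =i pred0)
    (a : fps K) (a0 : a 0%N = 1)
    (b : nat -> K) (logF : forall n, (0 < n)%N -> fps_log a n = b n / n%:R) :
  let R := Rfun a in
  (* (a) *)
  [/\ (forall n, bcoef (@schur K) n (R n) (row_partn n) = a n) /\
      (forall n (f : varfam K), homog_symfun n f ->
         bcoef (@schur K) n f (row_partn n) = \sum_(l <- partns n) bcoef (@hfun K) n f l),
  (* (b) *)
      forall n, bcoef (@schur K) n (R n) (nseq n 1%N) =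
                fps_inv (fps_dil (-1) a) n,
  (* (c) *)
      [/\ forall k, (0 < k)%N -> forall n,
            bcoef (@hfun K) (k * n) (R (k * n)%N) (nseq n k) =
            fps_exp (fps_opp (fps_dil (-1) (fps_logser (fun i => b (k * i)%N)))) n,
          forall k, (0 < k)%N -> forall n,
            bcoef (@hfun K) (k * n) (R (k * n)%N) (nseq n k) =
            fps_inv (fps_dil (-1) (fps_exp (fps_logser (fun i => b (k * i)%N)))) n
        & forall n, (0 < n)%N -> bcoef (@hfun K) n (R n) [:: n] = b n],
  (* (d) *)
      forall i j n, (0 < i)%N -> (0 < j)%N -> (i + j)%N = n ->
        bcoef (@hfun K) n (R n) [:: maxn i j; minn i j] =
        if i == j then (b i ^+ 2 - b n) / 2%:R else b i * b j - b n
    & (* (e) *)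
      (forall k n, eval_ones k (R n) = fps_pow a k n) /\
  (* (f) *)
      (let P : fps {poly K} :=
         fps_mul (fun m => (a m)%:P) (fps_inv (fps_dil (- 'X) (fun m => (a m)%:P))) in
       forall n, (0 < n)%N ->
         [/\ (size (P n) <= n.+1)%N,
             (1 + 'X %| P n)%R
           & P n %/ (1 + 'X) =
             \sum_(k < n) bcoef (@schur K) n (R n) ((n - k)%N :: nseq k 1%N) *: 'X^k])].
Proof.
move=> R; split.
- split=> [n|n f homf]; [exact: bcoef_schur_row_Rfun|exact: bcoef_schur_row_hfun].
- exact: bcoef_schur_column.
- split=> [k k_gt0 n|k k_gt0 n|n n_gt0]; first exact: bcoef_hfun_rect.
    by rewrite (bcoef_hfun_rect charK0 a0 logF) // (fps_inv_dil_exp charK0).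
  have := bcoef_hfun_rect charK0 a0 logF 1 n_gt0; rewrite muln1 => ->.
  by rewrite fps_exp_coef1 /fps_opp /fps_dil /= muln1 expr1 mulN1r opprK divr1.
- by move=> i j n; apply: bcoef_hfun_two.
split=> [|P n n_gt0]; first exact: eval_ones_Rfun.
have PE : P n = \sum_(j < n.+1) (a (n - j)%N * column_det a j) *: 'X^j :=
  mul_inv_dilX_coef a0 n.
have X1_neq0 : 1 + 'X != 0 :> {poly K} by rewrite addrC -size_poly_gt0 size_XaddC.
split.
- by rewrite PE -(poly_def _ (fun j => a (n - j)%N * column_det a j)) size_poly.
- by rewrite PE hook_series_coef // dvdp_mulr.
by rewrite PE hook_series_coef // mulKp //; apply: eq_bigr => k _;
  rewrite bcoef_schur_hook.
Qed.
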